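(* Let $D\subset\mathbb{R}^2$ be a bounded strictly convex domain with $C^2$ boundary $\Gamma$. Then for every $0<\epsilon<\pi/2$ there exist $b>0$ and an integer $N>0$ such that the density $p^N_\epsilon$ of the $N$-step transition kernel $P^N_\epsilon$ of the stochastically perturbed billiard in $D$ satisfies $$p^N_\epsilon(x,y)>b\qquad\text{for all }x,y\in M.$$
   Context: Strict convexity means $\Gamma$ contains no line segment; isolated points of zero curvature are allowed. Let $|\Gamma|$ be the length of $\Gamma$, parametrized by arc length $s$ (taken modulo $|\Gamma|$) and positively oriented. The phase space is the compact cylinder $M=\{(s,\theta):0\le s<|\Gamma|,\ 0\le\theta\le\pi\}$. A point $(s,\theta)$ represents the boundary point $q\in\Gamma$ with parameter $s$ together with the unit vector $v$ pointing into $D$ (or tangent to $\Gamma$) that makes angle $\theta$ with the oriented tangent line to $\Gamma$ at $q$. For $x\in M$, write $s(x),\theta(x)$ for its coordinates. Deterministic billiard map $T:M\to M$: for $x=(s,\theta)$ with $0<\theta<\pi$, representing $(q_0,v_0)$, let $q_1$ be the next point where the oriented line through $q_0$ with direction $v_0$ hits $\Gamma$, and let $v_1=v_0-2\langle n(q_1),v_0\rangle n(q_1)$, where $n(q_1)$ is the inward unit normal at $q_1$. Then $Tx$ is the point of $M$ representing $(q_1,v_1)$. For $\theta\in\{0,\pi\}$, $Tx=x$. For $\theta\in[0,\pi]$ put $\theta^\epsilon=\min\{\max(\theta,\epsilon),\pi-\epsilon\}$. For $x=(s,\theta)\in M$ and Borel $A\subset M$ let $$Q^\epsilon_x(A)=\int_{\theta^\epsilon-\epsilon}^{\theta^\epsilon+\epsilon}\mathbf{1}_A(s,u)\,\frac{1}{2\epsilon}\,du,\qquad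 P_\epsilon(x,A)=Q^\epsilon_{Tx}(A).$$ The powers are $P_\epsilon^1=P_\epsilon$ and $P^{n+1}_\epsilon(x,A)=\int_M P_\epsilon(x,dy)P^n_\epsilon(y,A)$. For $n\ge2$, $p^n_\epsilon(x,\cdot)$ is the density of $P^n_\epsilon(x,\cdot)$ with respect to Lebesgue measure $dy=ds\,d\theta$ on $M$, that is, $P^n_\epsilon(x,A)=\int_A p^n_\epsilon(x,y)\,dy$ (so $N\ge 2$ is understood in the claim). The version is fixed as follows. Let $Tx=(s_1,\theta_1)$. For $s'\ne s_1$ let $\theta'=\theta'(s_1,s')\in(0,\pi)$ be the unique angle with $s(T(s_1,\theta'))=s'$, and let $\theta_1'=\theta(T(s_1,\theta'))$. Then $$p^2_\epsilon(x,(s',\theta))=\frac{1}{4\epsilon^2}\left|\frac{\partial\theta'}{\partial s'}\right|\mathbf{1}_{\{|\theta'-\theta_1^\epsilon|\le\epsilon\}}\mathbf{1}_{\{|\theta-(\theta_1')^\epsilon|\le\epsilon\}}$$ (defined for almost every $s'$ in general), with value $0$ when $s'=s_1$. For $n\ge2$, $p^{n+1}_\epsilon(x,y)=\int_M P_\epsilon(x,dz)\,p^n_\epsilon(z,y)$. Here $\left|\frac{\partial\theta'}{\partial s'}\right|$ denotes the reciprocal of $\left|\frac{\partial}{\partial\theta}\, s(T(s_1,\theta))\right|$ evaluated at $\theta=\theta'$. *)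

(* Defs.v *)
From HB Require Import structures.
From mathcomp Require Import all_boot all_order all_algebra.
From mathcomp Require Import all_classical all_reals all_analysis.
From mathcomp Require Import measurable_realfun lra.

Set Implicit Arguments.
Unset Strict Implicit.
Unset Printing Implicit Defensive.

Import Order.TTheory GRing.Theory Num.Theory.
Import numFieldNormedType.Exports.

Local Open Scope classical_set_scope.
Local Open Scope ring_scope.

Notation plane R := (R^o * R^o)%type.

Section domain.
Context {R : realType}.
Implicit Types (D : set (plane R)) (L : R) (gamma : R -> plane R).

Definition dot (u v : plane R) : R := u.1 * v.1 + u.2 * v.2.

(* counterclockwise rotation by pi / 2 *)
Definition rot90 (u : plane R) : plane R := (- u.2, u.1).

Definition boundary D : set (plane R) := closure D `\` interior D.

Definition contains_no_segment (G : set (plane R)) : Prop :=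
  forall a b : plane R, a != b ->
    ~ ([set a + t *: (b - a) | t in `[0, 1]%classic] `<=` G).

Definition strictly_convex_domain D : Prop :=
  [/\ open D, D !=set0, bounded_set D, convex_set D
    & contains_no_segment (boundary D)].

Definition C2 (f : R -> R) : Prop :=
  [/\ forall t, derivable f t 1, forall t, derivable (derive1 f) t 1
    & continuous (derive1 (derive1 f))].

Definition tangent gamma (s : R) : plane R :=
  (derive1 (fst \o gamma) s, derive1 (snd \o gamma) s).

(* Left unit normal; for a positively oriented boundary it points inward. *)
Definition normal gamma (s : R) : plane R := rot90 (tangent gamma s).

(* gamma : R -> R^2 is an L-periodic C^2 parametrization by arc length of the
   simple closed curve bounding D, so that L is the length of the curve.
   Positive orientation means that D lies to the left of the oriented
   tangent. *)
Record boundary_param D L gamma : Prop := BoundaryParam {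
  bp_length_gt0 : 0 < L;
  bp_C2 : C2 (fst \o gamma) /\ C2 (snd \o gamma);
  bp_unit_speed : forall s, dot (tangent gamma s) (tangent gamma s) = 1;
  bp_periodic : forall s, gamma (s + L) = gamma s;
  bp_simple : {in `[0, L[ &, injective gamma};
  bp_image : gamma @` `[0, L[%classic = boundary D;
  bp_positive : forall s, \forall t \near 0^'+,
    D (gamma s + t *: normal gamma s)
}.

End domain.

(* The cylinder, with the circle R / L Z represented by [0, L[. *)
Definition phase_space {R : realType} (L : R) : set (R * R) :=
  `[0, L[%classic `*` `[0, pi]%classic.

Section billiard_map.
Context {R : realType} (L : R) (gamma : R -> plane R).

Definition direction (x : R * R) : plane R :=
  cos x.2 *: tangent gamma x.1 + sin x.2 *: normal gamma x.1.

(* By strict convexity a ray entering the domain meets the boundary at exactly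
   one positive time, so the infimum is attained. *)
Definition next_point (q v : plane R) : plane R :=
  q + inf [set t | 0 < t /\ range gamma (q + t *: v)] *: v.

Definition reflect_at (s : R) (v : plane R) : plane R :=
  v - (2 * dot (normal gamma s) v) *: normal gamma s.

Definition billiard_map (x : R * R) : R * R :=
  if 0 < x.2 < pi then
    [get y : R * R |
      [/\ phase_space L y,
          gamma y.1 = next_point (gamma x.1) (direction x)
        & direction y = reflect_at y.1 (direction x)]]
  else x.

(* theta'(s1, s') *)
Definition aim (s1 s' : R) : R :=
  [get u : R | 0 < u < pi /\ (billiard_map (s1, u)).1 = s'].

(* The first coordinate of T(s1, u) is only defined modulo L and its
   representative in [0, L[ jumps when the trajectory hits gamma 0; for s1 in
   [0, L[ it is differentiated through its representative in [s1, s1 + L[,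
   which is continuous in u. *)
Definition hit_lift (s1 u : R) : R :=
  let s := (billiard_map (s1, u)).1 in if s < s1 then s + L else s.

(* |d theta' / d s'|, as the reciprocal of |d s(T(s1, u)) / d u| at u = theta' *)
Definition aim_deriv (s1 s' : R) : R :=
  `| derive1 (hit_lift s1) (aim s1 s') |^-1.

End billiard_map.

Section transition_kernel.
Context {R : realType}.
Notation mu := (@lebesgue_measure R).
Notation phase := (R * R)%type.

Definition clamp (eps u : R) : R := Num.min (Num.max u eps) (pi - eps).

Definition noise_window (eps u : R) : set R :=
  `[clamp eps u - eps, clamp eps u + eps]%classic.

Definition noise (eps : R) (x : R * R) (A : set phase) : \bar R :=
  (\int[mu]_(u in noise_window eps x.2)
     ((2 * eps)^-1 * \1_A (x.1, u))%:E)%E.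

Section noise_measure.
Variables (eps : R) (x : R * R).

(* No sign condition on eps is needed: the window is empty for eps < 0. *)
Let noise_density_ge0 (A : set phase) (u : R) : noise_window eps x.2 u ->
  (0 <= ((2 * eps)^-1 * \1_A (x.1, u))%:E)%E.
Proof.
rewrite /noise_window /= in_itv /= => /andP[h1 h2].
have e0 : 0 <= eps by lra.
by rewrite lee_fin mulr_ge0 // invr_ge0 mulr_ge0.
Qed.

Let measurable_noise_density (A : set phase) : measurable A ->
  measurable_fun (noise_window eps x.2)
    (EFin \o (fun u : R => (2 * eps)^-1 * \1_A (x.1, u))).
Proof.
move=> mA; apply/measurable_EFinP; apply: measurable_funM => //.
apply: measurable_funTS.
have m1 : measurable_fun setT (\1_A : R * R -> R) by exact: measurable_indic.
exact: (measurableT_comp m1 (pair1_measurable x.1)).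
Qed.

Let noise0 : noise eps x set0 = 0%E.
Proof. by apply: integral0_eq => u _; rewrite indicE in_set0 mulr0. Qed.

Let noise_ge0 (A : set phase) : (0 <= noise eps x A)%E.
Proof. by apply: integral_ge0 => u Iu; exact: noise_density_ge0. Qed.

Let noise_sigma_additive : semi_sigma_additive (noise eps x).
Proof.
move=> F mF tF mUF; apply: cvg_toP.
  apply: ereal_nondecreasing_is_cvgn => m n mn.
  by apply: lee_sum_nneg_natr => // k _ _; exact: noise_ge0.
rewrite -integral_nneseries //=.
- by apply: eq_integral => u _; rewrite EFinM indic_bigcup // -nneseriesZl.
- exact: measurable_itv.
- by move=> n; exact: measurable_noise_density.
- by move=> n u; exact: noise_density_ge0.
Qed.

HB.instance Definition _ := isMeasure.Build _ _ _ (noise eps x)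
  noise0 noise_ge0 noise_sigma_additive.

End noise_measure.

Variables (L : R) (gamma : R -> plane R) (eps : R).
Notation M := (phase_space L).

Definition transition (x : R * R) : set phase -> \bar R :=
  noise eps (billiard_map L gamma x).

HB.instance Definition _ (x : R * R) := Measure.on (transition x).

(* n-fold power of the kernel; the value at n = 0 is a convention *)
Fixpoint transition_pow (n : nat) (x : R * R) (A : set phase) : \bar R :=
  match n with
  | 0 => \d_x A
  | 1 => transition x A
  | (m.+1 as k).+1 => (\int[transition x]_(y in M) transition_pow k y A)%E
  end.

(* u = theta'(s1, s') and v = theta_1', where (s1, theta_1) = T x *)
Definition density2 (x y : R * R) : \bar R :=
  let x1 := billiard_map L gamma x in
  let u := aim L gamma x1.1 y.1 in
  let v := (billiard_map L gamma (x1.1, u)).2 in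
  if y.1 == x1.1 then 0%E
  else ((4 * eps ^+ 2)^-1 * aim_deriv L gamma x1.1 y.1
        * (`|u - clamp eps x1.2| <= eps)%R%:R
        * (`|y.2 - clamp eps v| <= eps)%R%:R)%:E.

(* The transition densities. The first clause fixes p n x only almost
   everywhere; the other two select the version, and determine p n for n >= 2
   everywhere on the phase space. *)
Record step_density (p : nat -> R * R -> R * R -> \bar R) : Prop :=
  StepDensity {
  sd_density : forall n (x : R * R) (A : set phase), (2 <= n)%N -> M x ->
    measurable A -> A `<=` M ->
    transition_pow n x A = (\int[mu \x mu]_(y in A) p n x y)%E;
  sd_two : forall x y : R * R, M x -> M y -> p 2%N x y = density2 x y;
  sd_succ : forall n (x y : R * R), (2 <= n)%N -> M x -> M y ->
    p n.+1 x y = (\int[transition x]_(z in M) p n z y)%E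
}.

End transition_kernel.

(* Main.v *)
From HB Require Import structures.
Require Import Defs.
From mathcomp Require Import all_boot all_order all_algebra.
From mathcomp Require Import all_classical all_reals all_analysis.
From mathcomp Require Import measurable_realfun zify ring lra.

Set Implicit Arguments.
Unset Strict Implicit.
Unset Printing Implicit Defensive.

Import Order.TTheory GRing.Theory Num.Theory.
Import numFieldNormedType.Exports.
Local Open Scope classical_set_scope.
Local Open Scope ring_scope.

(** A trajectory is a chain of chords of the curve.  A chord from [a] to [b]
leaves [a] at the angle [depart a b], arrives at [b] and is reflected at the
angle [arrive a b]; without noise the next chord [b] to [c] has
[depart b c = arrive a b], and with noise it may be any chord such that these
two angles differ by less than [eps].  The explicit two-step density and the
recursion for the later ones show that the [N]-step density is bounded below
near every pair [x], [y] such that [T x] and [y] are joined by a chain of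
[N - 1] such chords ([minorized2], [minorizedS]).  By compactness, a uniform
lower bound follows once any two phase points can be joined by chains of one
common number of chords ([uniformly_joined], [uniformly_minorized]).

That any chord leads to any other is a global fact: an orbit without noise may
stay forever near an elliptic periodic orbit or an invariant curve, and the
noise acts only on the angle.  The reason is that billiards preserve a measure.
Give the chord from [a] to [b] the density [chord_density a b da db], the
product of the sines of its angles with the curve divided by its length.  This
is symmetric in [a] and [b], and for fixed [b] it becomes the Lebesgue measure
on ]-1, 1[ when the chord is described by the cosine of its angle at [b]
([column_measure]).  Let [U] be the set of the chords that can be reached from
a given one.  For each [b], let [I] be the set of the cosines with which chords
of [U] arrive at [b], and [O] the set of those with which they leave it.  By
Tonelli's theorem the integrals over [b] of the lengths of [I] and [O] are both
the measure of [U] ([flux_balance]); on the other hand [O] contains all points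
of ]-1, 1[ within [eta = 1 - cos eps] of [I].  So for almost every [b],
thickening [I] by [eta] does not increase its length, and this forces [I] to be
empty or [eta]-dense ([thickening_full]); in the second case all chords that
leave [b] are in [U].  One such [b] exists, it sends chords of [U] to every
other point, hence almost every point has this property, and [U] consists of
all chords ([closed_set_of_chords_full], [reach_all]).

The number of chords can be prescribed because short chords are nearly tangent
to the curve and can be subdivided: one more position on a short arc makes a
chain longer by one chord without changing its first and last chords.  This
gives loops of two consecutive lengths at one chord, hence loops of all large
lengths there ([reach_loops]).

The shape of the table enters through one fact: the curve lies strictly to the
left of each of its tangents ([cross_gt0]).  Therefore the cosine of the angle
at [a] of the chord from [a] to [b] decreases strictly from 1 to -1 as [b] goes
once around the curve, so the chords that leave [a] are parametrized by their
angle in ]0, pi[, and the billiard map is the map of chords described above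
([billiard_map_chord]). *)

(** * Tangents of a convex curve *)

Section convexity.
Context {R : realType}.
Implicit Types (D : set (plane R)) (u v w x y : plane R).

Definition cross u v : R := u.1 * v.2 - u.2 * v.1.

Lemma convex_segment D x y (t : R) : convex_set D -> D x -> D y ->
  0 <= t <= 1 -> D (x + t *: (y - x)).
Proof.
move=> cD Dx Dy /andP[t0 t1].
have h01 : Itv.spec (@Itv.num_sem R) (Itv.Real `[0%Z, 1%Z]) t.
  by rewrite /Itv.spec /= /Itv.num_sem /= in_itv /= t0 t1 ger0_real.
have := cD y x (Itv.mk h01) (mem_set Dy) (mem_set Dx).
move=> /set_mem; congr D.
rewrite /conv /=.
rewrite /unstable.onem scalerBl scale1r scalerBr.
by rewrite addrCA addrA.
Qed.

(** Replace [x] by a point [z] of [D] close to it, and move [y] so that the segment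
from [z] still passes through the given point. *)
Lemma open_segment D x y (t : R) : convex_set D -> open D -> closure D x ->
  D y -> 0 < t <= 1 -> D (x + t *: (y - x)).
Proof.
move=> cD oD cx Dy /andP[t0 t1].
have /nbhs_ballP[r r0 hr] : nbhs y D by exact: open_nbhs_nbhs.
have [z [Dz bz]] : D `&` ball x (t * r) !=set0.
  by apply: cx; apply: nbhsx_ballx; rewrite mulr_gt0.
have tn : t != 0 by rewrite gt_eqF.
have Dw : D (y + (t^-1 * (1 - t)) *: (x - z)).
  apply: hr; rewrite -ball_normE /= opprD addrA subrr add0r normrN normrZ.
  move: bz; rewrite -ball_normE /= => bz.
  rewrite ger0_norm ?mulr_ge0 ?invr_ge0 ?subr_ge0 ?(ltW t0)//.
  rewrite -mulrA mulrC ltr_pdivrMr// [ltRHS]mulrC.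
  apply: le_lt_trans bz; rewrite ler_piMl//; lra.
have := convex_segment cD Dz Dw.
move=> /(_ t); rewrite (ltW t0) t1 => /(_ isT); congr D.
have e (a b c : R) : a + t * (b + t^-1 * (1 - t) * (c - a) - a) = c + t * (b - c).
  by field.
by rewrite [LHS]surjective_pairing [RHS]surjective_pairing; congr (_, _); exact: e.
Qed.

End convexity.

Section curve.
Context {R : realType} (D : set (plane R)) (L : R) (gamma : R -> plane R).
Hypothesis hD : strictly_convex_domain D.
Hypothesis hg : boundary_param D L gamma.
Implicit Types (a b s t : R).

Let L0 : 0 < L := bp_length_gt0 hg.

Lemma gamma_periodic (n : int) s : gamma (s + n%:~R * L) = gamma s.
Proof.
have nat_periodic (m : nat) t : gamma (t + m%:R * L) = gamma t.
  elim: m t => [|m IH] t; first by rewrite mul0r addr0.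
  by rewrite -natr1 mulrDl mul1r addrA (bp_periodic hg) IH.
case: n => m; first exact: nat_periodic.
by rewrite NegzE mulrNz mulNr -[in RHS](subrK (m.+1%:R * L) s) nat_periodic.
Qed.

Lemma fundamental_rep s : exists n : int, 0 <= s + n%:~R * L < L.
Proof.
exists (- Num.floor (s / L)).
have /andP[h1 h2] := floor_itv (s / L).
move: h1 h2; rewrite ler_pdivlMr// ltr_pdivrMr// => h1 h2.
rewrite mulrNz mulNr subr_ge0 h1/= ltrBlDr; move: h2.
by rewrite intrD mulrDl mul1r addrC.
Qed.

(** The curve is simple on one period only, so positions are determined by
their point up to the addition of a multiple of [L]. *)
Lemma eq_gammaP a b : gamma a = gamma b ->
  exists n : int, b = a + n%:~R * L.
Proof.
have [n hn] := fundamental_rep a; have [m hm] := fundamental_rep b.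
move=> eab; have : a + n%:~R * L = b + m%:~R * L.
  apply: (bp_simple hg); rewrite ?inE ?in_itv//=.
  by rewrite !gamma_periodic.
move=> e; exists (n - m); rewrite intrB mulrBl addrA e; lra.
Qed.

Lemma tangent_periodic (n : int) s : tangent gamma (s + n%:~R * L) = tangent gamma s.
Proof.
have der (f : R -> R) : (forall t, derivable f t 1) ->
    (forall t, f (t + n%:~R * L) = f t) -> derive1 f (s + n%:~R * L) = derive1 f s.
  move=> df pf; have {2}-> : f = f \o (fun t => t + n%:~R * L).
    by apply/funext => t /=; rewrite pf.
  have d1 : is_derive s 1 (fun t : R => t + n%:~R * L) 1.
    by apply: is_derive_eq; rewrite addr0.
  have d2 : is_derive (s + n%:~R * L) 1 f (derive1 f (s + n%:~R * L)).
    by rewrite derive1E; apply: DeriveDef.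
  have := @is_derive1_comp _ f (fun t => t + n%:~R * L) s _ _ d2 d1.
  by rewrite mulr1 [in RHS]derive1E => /@derive_val ->.
have [[d1 _ _] [d2 _ _]] := bp_C2 hg.
congr (_, _); apply: der.
- exact: d1.
- by move=> t; rewrite /= gamma_periodic.
- exact: d2.
- by move=> t; rewrite /= gamma_periodic.
Qed.

Lemma gamma_boundary s : boundary D (gamma s).
Proof.
have [n hn] := fundamental_rep s; rewrite -(bp_image hg).
by exists (s + n%:~R * L); rewrite ?gamma_periodic //= in_itv.
Qed.

Lemma gamma_notin s : ~ D (gamma s).
Proof.
by have [oD _ _ _ _] := hD; have [_ h] := gamma_boundary s => Ds; apply: h; exact: oD.
Qed.

Lemma gamma_closure s : closure D (gamma s).
Proof. by have [] := gamma_boundary s. Qed.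

Lemma is_derive_gamma1 s : is_derive s 1 (fst \o gamma) (tangent gamma s).1.
Proof.
by have [[d _ _] _] := bp_C2 hg; rewrite /= derive1E; apply: DeriveDef.
Qed.

Lemma is_derive_gamma2 s : is_derive s 1 (snd \o gamma) (tangent gamma s).2.
Proof.
by have [_ [d _ _]] := bp_C2 hg; rewrite /= derive1E; apply: DeriveDef.
Qed.

Lemma frameE (T w : plane R) : dot T T = 1 ->
  w = dot T w *: T + cross T w *: rot90 T.
Proof.
rewrite /dot /cross /rot90 => T1; rewrite [LHS]surjective_pairing.
congr (_, _); rewrite /= /GRing.scale /=.
- by rewrite -[LHS]mul1r -T1; ring.
- by rewrite -[LHS]mul1r -T1; ring.
Qed.

(** If [D] contained a point [q] of the tangent line at [gamma s], it would by
convexity contain a cone with apex [gamma s] over a neighbourhood of [q], and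
the curve, which is tangent to the line, would enter this cone. *)
Lemma tangent_line_outside s (r : R) : ~ D (gamma s + r *: tangent gamma s).
Proof.
have [oD _ _ cD _] := hD => Dq.
have r0 : r != 0.
  by apply/eqP => r0; apply: (@gamma_notin s); move: Dq; rewrite r0 scale0r addr0.
(* Coordinates of the point of the curve at [s + l * r], rescaled by [1 / l] from
     the center [gamma s]; they tend to those of [q = gamma s + r *: tangent]. *)
pose chordal (f : R -> R) (l : R) := f s + l^-1 * (f (s + l * r) - f s).
have cvg_chordal f df : is_derive s 1 f df -> chordal f x @[x --> 0^'+] --> f s + r * df.
  move=> hf; apply: cvgD; first exact: cvg_cst.
  have d1 : is_derive (0:R) 1 (fun l : R => s + l * r) r.
    by apply: is_derive_eq; rewrite !add0r mul1r scaler0 add0r /GRing.scale /= mulr1.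
  have d2 : is_derive (s + 0 * r) 1 f df by rewrite mul0r addr0.
  have [dd de] := @is_derive1_comp _ f (fun l => s + l * r) 0 _ _ d2 d1.
  rewrite mulrC -de.
  have : (fun h : R => h^-1 *: ((f \o (fun l => s + l * r)) (h *: 1 + 0) -
      (f \o (fun l => s + l * r)) 0)) h @[h --> 0^'+] --> 'D_1 (f \o (fun l => s + l * r)) 0.
    by apply: cvg_dnbhs_at_right; exact: dd.
  move=> hh; apply: cvg_trans hh; apply: near_eq_cvg; near=> h.
  by rewrite /= mul0r !addr0 /GRing.scale /= mulr1.
have cq : (chordal (fst \o gamma) x, chordal (snd \o gamma) x) @[x --> 0^'+] -->
    ((gamma s).1 + r * (tangent gamma s).1, (gamma s).2 + r * (tangent gamma s).2).
  have c1 := cvg_chordal _ _ (is_derive_gamma1 s).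
  have c2 := cvg_chordal _ _ (is_derive_gamma2 s).
  exact: (cvg_pair c1 c2).
have nD : \forall x \near 0^'+, D (chordal (fst \o gamma) x, chordal (snd \o gamma) x).
  by apply: cq; move: (oD _ Dq).
near (0:R)^'+ => x.
apply: (@gamma_notin (s + x * r)).
have : D (gamma s + x *: ((chordal (fst \o gamma) x, chordal (snd \o gamma) x) - gamma s)).
  apply: open_segment => //; first exact: gamma_closure.
  - by near: x.
  - apply/andP; split => //; near: x; exact: nbhs_right_le.
congr D; rewrite [LHS]surjective_pairing [RHS]surjective_pairing.
have x0 : x != 0 by rewrite gt_eqF.
by congr (_, _); rewrite /chordal /= /GRing.scale /=; field.
Unshelve. all: by end_near.
Qed.

(** The inward normal starts on the left of the tangent line.  A point of [D] on
the other side would be joined inside [D] to a point of this normal, and the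
segment would meet the tangent line. *)
Lemma cross_inside s p : D p -> 0 < cross (tangent gamma s) (p - gamma s).
Proof.
have [oD _ _ cD _] := hD => Dp; rewrite ltNge; apply/negP => c0.
set T := tangent gamma s in c0 *; have T1 : dot T T = 1 := bp_unit_speed hg s.
have [t [t0 Dt]] : exists t, 0 < t /\ D (gamma s + t *: normal gamma s).
  near (0:R)^'+ => t; exists t; split; first by [].
  by near: t; exact: bp_positive hg s.
set c1 := cross T (p - gamma s) in c0.
(* The parameter at which the segment from the point of the normal to [p] meets
     the tangent line. *)
pose l := t / (t - c1).
have tc : 0 < t - c1 by lra.
have Dq : D (gamma s + t *: normal gamma s + l *: (p - (gamma s + t *: normal gamma s))).
  apply: convex_segment => //; apply/andP; split.
    by rewrite divr_ge0// ltW.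
  by rewrite ler_pdivrMr// mul1r; lra.
set q := (X in D X) in Dq.
have q0 : cross T (q - gamma s) = 0.
  have -> : cross T (q - gamma s) = t * dot T T + l * (c1 - t * dot T T).
    rewrite /c1 /q /cross /dot /normal -/T /rot90 /= /GRing.scale /=; ring.
  rewrite T1 mulr1 /l; field; exact: lt0r_neq0.
apply: (@tangent_line_outside s (dot T (q - gamma s))).
have -> // : gamma s + dot T (q - gamma s) *: T = q.
rewrite -[RHS](subrK (gamma s)) addrC; congr (_ + _).
by rewrite [RHS](frameE _ T1) q0 scale0r addr0.
Unshelve. all: by end_near.
Qed.

Lemma cross_closure_ge0 s p : closure D p -> 0 <= cross (tangent gamma s) (p - gamma s).
Proof.
set T := tangent gamma s => clp; rewrite leNgt; apply/negP => c0.
have cc : {for p, continuous (fun x : plane R => cross T (x - gamma s))}.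
  have h2 : (fun x : plane R => x.2 - (gamma s).2) x @[x --> p] --> p.2 - (gamma s).2.
    by apply: cvgB; [exact: cvg_snd|exact: cvg_cst].
  have h1 : (fun x : plane R => x.1 - (gamma s).1) x @[x --> p] --> p.1 - (gamma s).1.
    by apply: cvgB; [exact: cvg_fst|exact: cvg_cst].
  exact: cvgB (cvgM (cvg_cst T.1) h2) (cvgM (cvg_cst T.2) h1).
have [q [Dq /= hq]] : D `&` [set x | cross T (x - gamma s) < 0] !=set0.
  by apply: clp; apply: (cc [set y | y < 0]); exact: lt_nbhsl.
by have := cross_inside s Dq; rewrite -/T; lra.
Qed.

Lemma closure_segment x y t : closure D x -> closure D y -> 0 <= t <= 1 ->
  closure D (x + t *: (y - x)).
Proof.
have [oD [q Dq] _ cD _] := hD => cx cy t01 V.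
set z := x + _.
have cc : (fun l : R => z + l *: (q - z)) l @[l --> 0^'+] --> z.
  rewrite -[X in _ --> X]addr0 -[X in z + X](scale0r (q - z)).
  apply: cvgD; first exact: cvg_cst.
  apply: cvgZr_tmp; apply: cvg_at_right_filter; exact: cvg_id.
move=> /cc nV; near (0:R)^'+ => l.
exists (z + l *: (q - z)); split; last by near: l.
have l01 : 0 < l <= 1.
  by apply/andP; split => //; near: l; exact: nbhs_right_le.
have Dx : D (x + l *: (q - x)) by exact: open_segment.
have Dy : D (y + l *: (q - y)) by exact: open_segment.
have := convex_segment cD Dx Dy t01.
congr D; rewrite /z [LHS]surjective_pairing [RHS]surjective_pairing.
by congr (_, _); rewrite /= /GRing.scale /=; ring.
Unshelve. all: by end_near.
Qed.

(** If [gamma b] were on the tangent line at [gamma a], the whole chord would be on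
that line, hence outside [D] and in its closure: a segment in the boundary. *)
Lemma cross_gt0 a b : gamma a <> gamma b ->
  0 < cross (tangent gamma a) (gamma b - gamma a).
Proof.
move=> ab; rewrite lt_neqAle cross_closure_ge0 ?andbT; last exact: gamma_closure.
apply/eqP => c0; have [oD _ _ _ noseg] := hD.
have : gamma a != gamma b by exact/eqP.
move=> /noseg; apply => z /= [t /=]; rewrite in_itv /= => t01 <-.
split; first by apply: closure_segment => //; exact: gamma_closure.
move=> /interior_subset Dz; have := cross_inside a Dz.
rewrite addrAC subrr add0r.
have -> : cross (tangent gamma a) (t *: (gamma b - gamma a)) =
    t * cross (tangent gamma a) (gamma b - gamma a).
  by rewrite /cross /= /GRing.scale /=; ring.
by rewrite -c0 mulr0 ltxx.
Qed.

End curve.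

(** * The cosine of the angle of a chord *)

Section aim_cosine.
Context {R : realType} (D : set (plane R)) (L : R) (gamma : R -> plane R).
Hypothesis hD : strictly_convex_domain D.
Hypothesis hg : boundary_param D L gamma.
Implicit Types (a b s t : R).

Local Notation T := (tangent gamma).

Definition chord_len a b := Num.sqrt (dot (gamma b - gamma a) (gamma b - gamma a)).

(** Cosine of the angle at [a] between the tangent and the chord towards [b].
Seen from the other end, the chord that goes from [a] to [b] and is reflected
there makes with the tangent at [b] the angle of cosine [- aimcos b a]. *)
Definition aimcos a b := dot (T a) (gamma b - gamma a) / chord_len a b.

Definition aimsin a b := cross (T a) (gamma b - gamma a) / chord_len a b.

(** The mixed second derivative of [chord_len]: the density, in the end points, of
the measure on chords that the billiard map preserves. *)
Definition chord_density a b := aimsin a b * aimsin b a / chord_len a b.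

Lemma dot_gt0 (u : plane R) : u != 0 -> 0 < dot u u.
Proof.
move=> u0; rewrite /dot -!expr2 lt0r addr_ge0 ?sqr_ge0// andbT.
apply: contra u0; rewrite paddr_eq0 ?sqr_ge0// !sqrf_eq0 => /andP[/eqP e1 /eqP e2].
by rewrite [u]surjective_pairing e1 e2.
Qed.

Lemma chord_lenC a b : chord_len a b = chord_len b a.
Proof. by rewrite /chord_len; congr Num.sqrt; rewrite /dot /=; ring. Qed.

Lemma chord_len_gt0 a b : gamma a <> gamma b -> 0 < chord_len a b.
Proof.
by move=> ab; rewrite sqrtr_gt0 dot_gt0// subr_eq0; apply/eqP => /esym.
Qed.

Lemma chord_len_neq0 a b : gamma a <> gamma b -> chord_len a b != 0.
Proof. by move=> ab; rewrite gt_eqF// chord_len_gt0. Qed.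

Lemma sqr_chord_len a b :
  chord_len a b ^+ 2 = dot (gamma b - gamma a) (gamma b - gamma a).
Proof. by rewrite sqr_sqrtr// /dot -!expr2 addr_ge0 ?sqr_ge0. Qed.

Lemma sqr_dotDcross (u v : plane R) : dot u v ^+ 2 + cross u v ^+ 2 = dot u u * dot v v.
Proof. by rewrite /dot /cross; ring. Qed.

Lemma aimcos2Dsin2 a b : gamma a <> gamma b -> aimcos a b ^+ 2 + aimsin a b ^+ 2 = 1.
Proof.
move=> ab; rewrite !expr_div_n -mulrDl sqr_dotDcross (bp_unit_speed hg) mul1r sqr_chord_len.
by rewrite divff// -sqr_chord_len sqrf_eq0 chord_len_neq0.
Qed.

Lemma aimsin_gt0 a b : gamma a <> gamma b -> 0 < aimsin a b.
Proof. by move=> ab; rewrite divr_gt0 ?chord_len_gt0//; exact: cross_gt0 hD hg _ _ ab. Qed.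

Lemma aimcos_itv a b : gamma a <> gamma b -> -1 < aimcos a b < 1.
Proof.
move=> ab; have e := aimcos2Dsin2 ab.
have s2 : 0 < aimsin a b ^+ 2 by rewrite exprn_gt0 ?aimsin_gt0.
rewrite -ltr_norml -[ltRHS]normr1 -ltr_sqr ?nnegrE// !real_normK ?num_real// expr1n.
lra.
Qed.

Lemma aimsinE a b : gamma a <> gamma b -> aimsin a b = Num.sqrt (1 - aimcos a b ^+ 2).
Proof.
move=> ab; rewrite -(aimcos2Dsin2 ab) addrAC subrr add0r sqrtr_sqr gtr0_norm//.
exact: aimsin_gt0.
Qed.

Lemma chord_densityC a b : chord_density a b = chord_density b a.
Proof. by rewrite /chord_density chord_lenC [aimsin a b * _]mulrC. Qed.

Lemma chord_density_gt0 a b : gamma a <> gamma b -> 0 < chord_density a b.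
Proof.
move=> ab; have ba : gamma b <> gamma a by move=> /esym.
exact: divr_gt0 (mulr_gt0 (aimsin_gt0 ab) (aimsin_gt0 ba)) (chord_len_gt0 ab).
Qed.

(** As [aimcos a b] is minus the derivative of [chord_len a b] in [a], this is the
mixed derivative of the length. *)
Lemma is_derive_aimcos a b : gamma a <> gamma b ->
  is_derive b 1 (aimcos a) (- chord_density a b).
Proof.
move=> ab.
have d1 := is_derive_gamma1 hg b; have d2 := is_derive_gamma2 hg b.
set x := fst \o gamma in d1; set y := snd \o gamma in d2.
pose Q s := (x s - x a) * (x s - x a) + (y s - y a) * (y s - y a).
have dQ : is_derive b 1 Q (2 * dot (gamma b - gamma a) (T b)).
  rewrite /Q; apply: is_derive_eq; rewrite /dot /x /y /= /GRing.scale /=; ring.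
have Q0 : 0 < Q b.
  apply: (@dot_gt0 (gamma b - gamma a)); rewrite subr_eq0; apply/eqP => /esym; exact: ab.
have dl : is_derive b 1 (chord_len a) ((2 * Num.sqrt (Q b))^-1 * (2 * dot (gamma b - gamma a) (T b))).
  exact: (is_derive1_comp (is_derive1_sqrt Q0) dQ).
have l0 := chord_len_neq0 ab.
have dv := is_deriveV l0 dl.
have dn : is_derive b 1 (fun s => (T a).1 * (x s - x a) + (T a).2 * (y s - y a)) (dot (T a) (T b)).
  apply: is_derive_eq; rewrite /dot /x /y /= /GRing.scale /=; ring.
apply: is_derive_eq (is_deriveM dn dv) _.
have -> : Num.sqrt (Q b) = chord_len a b by [].
have e2 : dot (gamma b - gamma a) (gamma b - gamma a) / chord_len a b ^+ 2 = 1.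
  by rewrite -sqr_chord_len divff// expf_neq0.
have -> : dot (T a) (T b) = dot (T a) (T b) * dot (gamma b - gamma a) (gamma b - gamma a)
    / chord_len a b ^+ 2 by rewrite -mulrA e2 mulr1.
rewrite /chord_density /aimsin [chord_len b a]chord_lenC.
rewrite /x /y /dot /cross /= /GRing.scale /=; field.
exact: l0.
Qed.

Lemma continuous_derivable (f : R -> R) : (forall t, derivable f t 1) -> continuous f.
Proof. by move=> df t; apply: differentiable_continuous; exact/derivable1_diffP. Qed.

Section curve_limits.
Context {I : Type} {F : set_system I} {FF : Filter F} {f : I -> R} {a : R}.
Hypothesis fa : f x @[x --> F] --> a.

Lemma cvg_tangent1 : (T (f x)).1 @[x --> F] --> (T a).1.
Proof.
have [[_ d _] _] := bp_C2 hg.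
by apply: (cvg_comp f (derive1 (fst \o gamma)) fa); exact: continuous_derivable d a.
Qed.

Lemma cvg_tangent2 : (T (f x)).2 @[x --> F] --> (T a).2.
Proof.
have [_ [_ d _]] := bp_C2 hg.
by apply: (cvg_comp f (derive1 (snd \o gamma)) fa); exact: continuous_derivable d a.
Qed.

Lemma cvg_gamma1 : (gamma (f x)).1 @[x --> F] --> (gamma a).1.
Proof.
have [[d _ _] _] := bp_C2 hg.
by apply: (cvg_comp f (fst \o gamma) fa); exact: continuous_derivable d a.
Qed.

Lemma cvg_gamma2 : (gamma (f x)).2 @[x --> F] --> (gamma a).2.
Proof.
have [_ [d _ _]] := bp_C2 hg.
by apply: (cvg_comp f (snd \o gamma) fa); exact: continuous_derivable d a.
Qed.
End curve_limits.

Section chord_limits.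
Context {I : Type} {F : set_system I} {FF : Filter F} {f g : I -> R} {a b : R}.
Hypotheses (fa : f x @[x --> F] --> a) (gb : g x @[x --> F] --> b).

Let c1 : (gamma (g x)).1 - (gamma (f x)).1 @[x --> F] --> (gamma b).1 - (gamma a).1.
Proof. exact: cvgB (cvg_gamma1 gb) (cvg_gamma1 fa). Qed.

Let c2 : (gamma (g x)).2 - (gamma (f x)).2 @[x --> F] --> (gamma b).2 - (gamma a).2.
Proof. exact: cvgB (cvg_gamma2 gb) (cvg_gamma2 fa). Qed.

Lemma cvg_chord_len : chord_len (f x) (g x) @[x --> F] --> chord_len a b.
Proof.
apply: (cvg_comp _ (@Num.sqrt R)); last exact: sqrt_continuous.
exact: cvgD (cvgM c1 c1) (cvgM c2 c2).
Qed.

Hypothesis ab : gamma a <> gamma b.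

Lemma cvg_chord_lenV : (chord_len (f x) (g x))^-1 @[x --> F] --> (chord_len a b)^-1.
Proof. exact: cvgV (chord_len_neq0 ab) cvg_chord_len. Qed.

Lemma cvg_aimcos : aimcos (f x) (g x) @[x --> F] --> aimcos a b.
Proof.
exact: cvgM (cvgD (cvgM (cvg_tangent1 fa) c1) (cvgM (cvg_tangent2 fa) c2)) cvg_chord_lenV.
Qed.

Lemma cvg_aimsin : aimsin (f x) (g x) @[x --> F] --> aimsin a b.
Proof.
exact: cvgM (cvgB (cvgM (cvg_tangent1 fa) c2) (cvgM (cvg_tangent2 fa) c1)) cvg_chord_lenV.
Qed.

Lemma near_chord : \forall x \near F, gamma (f x) <> gamma (g x).
Proof.
have h := cvg_chord_len (lt_nbhsr (chord_len_gt0 ab)).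
near=> x => e; have : 0 < chord_len (f x) (g x) by near: x; exact: h.
by rewrite /chord_len e subrr /dot /= mulr0 addr0 sqrtr0 ltxx.
Unshelve. all: by end_near.
Qed.
End chord_limits.

End aim_cosine.

(** * Chords from a point are parametrized by their angle *)

Section monotonicity.
Context {R : realType}.

Lemma is_derive_gt0_lt (h dh : R -> R) (x y : R) : x < y ->
  (forall z, x <= z <= y -> is_derive z 1 h (dh z)) ->
  (forall z, x <= z <= y -> 0 < dh z) -> h x < h y.
Proof.
move=> xy hd d0.
have der z : z \in `]x, y[ -> is_derive z 1 h (dh z).
  by rewrite in_itv /= => /andP[xz zy]; apply: hd; rewrite !ltW.
have [|c] := MVT xy der.
  apply: derivable_within_continuous => z; rewrite in_itv /= => /hd h1.
  by have [] := h1.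
rewrite in_itv /= => /andP[xc cy] e; rewrite -subr_gt0 e mulr_gt0 ?subr_gt0//.
by apply: d0; rewrite !ltW.
Qed.

End monotonicity.

Section aim_bijection.
Context {R : realType} (D : set (plane R)) (L : R) (gamma : R -> plane R).
Hypothesis hD : strictly_convex_domain D.
Hypothesis hg : boundary_param D L gamma.
Implicit Types (a b s t : R).

Local Notation T := (tangent gamma).
Local Notation k := (aimcos gamma).
Local Notation len := (chord_len gamma).

Let L0 : 0 < L := bp_length_gt0 hg.

Lemma gamma_neq a b : a < b < a + L -> gamma a <> gamma b.
Proof.
move=> /andP[ab baL] /(eq_gammaP hg)[n bE].
have n0 : 0 < n%:~R * L by lra.
have n1 : n%:~R * L < 1 * L by lra.
move: n0 n1; rewrite pmulr_lgt0// ltr_pM2r// ltr0z ltrz1 => h1 h2; by case: n h1 h2 {bE} => [[|m]|m].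
Qed.

Lemma chord_rep a b : gamma a <> gamma b ->
  exists b', a < b' < a + L /\ gamma b' = gamma b.
Proof.
move=> ab; have [n /andP[n0 n1]] := fundamental_rep hg (b - a).
exists (b + n%:~R * L); rewrite (gamma_periodic hg); split => //.
rewrite lt_neqAle andbC; apply/andP; split; first by lra.
apply/andP; split; last by lra.
by apply/eqP => e; apply: ab; rewrite e (gamma_periodic hg).
Qed.

Lemma gamma_tangent a b : gamma a = gamma b -> T a = T b.
Proof. by move=> /(eq_gammaP hg)[n ->]; rewrite (tangent_periodic hg). Qed.

Lemma aimcos_eq a b a' b' : gamma a = gamma a' -> gamma b = gamma b' -> k a b = k a' b'.
Proof.
by move=> ea eb; rewrite /aimcos /chord_len (gamma_tangent ea) ea eb.
Qed.

Lemma aimsin_eq a b a' b' : gamma a = gamma a' -> gamma b = gamma b' ->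
  aimsin gamma a b = aimsin gamma a' b'.
Proof.
by move=> ea eb; rewrite /aimsin /chord_len (gamma_tangent ea) ea eb.
Qed.

Lemma is_derive_opp_aimcos b a : gamma b <> gamma a ->
  is_derive a 1 (fun x => - k b x) (chord_density gamma b a).
Proof.
move=> ba; have := is_deriveN (is_derive_aimcos hg ba).
by rewrite opprK.
Qed.

Lemma aimcos_decr a x y : x < y ->
  (forall t, x <= t <= y -> gamma a <> gamma t) -> k a y < k a x.
Proof.
move=> xy ac; rewrite -ltrN2.
apply: (is_derive_gt0_lt (h := fun t => - k a t) (dh := chord_density gamma a) xy).
- by move=> t /ac; exact: is_derive_opp_aimcos.
- by move=> t /ac; exact: (chord_density_gt0 hD hg).
Qed.

(** Two positions at which [aimcos a] agrees are moved into ]a, a + L[, where it is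
strictly monotone. *)
Lemma aimcos_inj a b b' : gamma a <> gamma b -> gamma a <> gamma b' ->
  k a b = k a b' -> gamma b = gamma b'.
Proof.
move=> /chord_rep[x [/andP[ax xaL] xb]] /chord_rep[y [/andP[ay yaL] yb]].
rewrite -xb -yb -(@aimcos_eq a x a b)// -(@aimcos_eq a y a b')// => kxy.
have aux u v : a < u -> v < a + L -> u < v -> k a v < k a u.
  move=> au va uv; apply: aimcos_decr => // t /andP[ut tv]; apply: gamma_neq; lra.
by have [xy|yx|->//] := ltgtP x y;
  [have := aux _ _ ax yaL xy|have := aux _ _ ay xaL yx]; rewrite kxy ltxx.
Qed.

Lemma chord_mean_value (w : plane R) x y : x < y -> exists2 c, x < c < y &
  dot w (gamma y - gamma x) = (y - x) * dot w (T c).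
Proof.
move=> xy.
have der t : is_derive t 1 (fun t => w.1 * (gamma t).1 + w.2 * (gamma t).2) (dot w (T t)).
  have d1 := is_derive_gamma1 hg t; have d2 := is_derive_gamma2 hg t.
  have := is_deriveD (is_deriveZ w.1 d1) (is_deriveZ w.2 d2); exact.
have [|c] := MVT xy (fun t _ => der t).
  by apply: derivable_within_continuous => t _; have [] := der t.
rewrite in_itv /= => cxy e; exists c => //.
by rewrite mulrC -e /dot /=; ring.
Qed.

Lemma chord_len_le x y : x < y -> len x y <= y - x.
Proof.
move=> xy; have [->|l0] := eqVneq (len x y) 0; first by lra.
have lp : 0 < len x y by rewrite lt_neqAle eq_sym l0 sqrtr_ge0.
have [c _ e] := chord_mean_value (gamma y - gamma x) xy.
rewrite -sqr_chord_len in e.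
have h : dot (gamma y - gamma x) (T c) <= len x y.
  have := sqr_dotDcross (gamma y - gamma x) (T c).
  rewrite (bp_unit_speed hg) mulr1 -sqr_chord_len => h.
  rewrite -[leRHS]ger0_norm ?sqrtr_ge0//; apply: le_trans (ler_norm _) _.
  rewrite -ler_sqr ?nnegrE// !real_normK ?num_real// -h lerDl sqr_ge0//.
rewrite -(ler_pM2r lp) -expr2 e ler_pM2l//; lra.
Qed.

(** The mean value theorem turns the chord into a multiple of a tangent taken in
between, which is close to the tangents at both ends because the curve is C^1.
Therefore [aimcos] tends to 1 at the start of short forward chords and to -1
at their end. *)
Lemma near_diagonal a (e : R) : 0 < e -> exists2 d, 0 < d & forall x y,
  a - d < x -> x < y -> y < a + d ->
  [/\ gamma x <> gamma y, 1 - e < k x y & 1 - e < - k y x].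
Proof.
move=> e0; pose e' := Num.min e (1 / 2).
have e'0 : 0 < e' by rewrite lt_min e0 /= divr_gt0.
have [e'e e'1] : e' <= e /\ e' < 1.
  by rewrite /e' ge_min lexx gt_min; split => //; apply/orP; right; lra.
have c : dot (T p.1) (T p.2) @[p --> (a, a)] --> dot (T a) (T a).
  have c1 : (@fst R R) x @[x --> (a, a)] --> a by exact: cvg_fst.
  have c2 : (@snd R R) x @[x --> (a, a)] --> a by exact: cvg_snd.
  exact: cvgD (cvgM (cvg_tangent1 hg c1) (cvg_tangent1 hg c2))
              (cvgM (cvg_tangent2 hg c1) (cvg_tangent2 hg c2)).
have := c [set u | 1 - e' < u]; rewrite (bp_unit_speed hg) => h.
have /nbhs_ballP[d /= d0 hd] : nbhs (a, a) [set p | 1 - e' < dot (T p.1) (T p.2)].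
  by apply: h; apply: lt_nbhsr; lra.
exists (Num.min d (L / 2)) => [|x y]; first by rewrite lt_min d0 divr_gt0.
set m := Num.min d (L / 2); move=> ax xy ya.
have [md mL] : m <= d /\ m <= L / 2 by rewrite !ge_min !lexx orbT.
have ne : gamma x <> gamma y by apply: gamma_neq; lra.
have lp := chord_len_gt0 ne; have ll := chord_len_le xy.
have near u v : x <= u <= y -> x <= v <= y -> 1 - e' < dot (T u) (T v).
  move=> hu hv; apply: (hd (u, v)); split => /=;
    rewrite -ball_normE /= ltr_distlC; lra.
have aux u : (forall v, x <= v <= y -> 1 - e' < dot (T u) (T v)) ->
    1 - e < dot (T u) (gamma y - gamma x) / len x y.
  move=> h1; have [v /andP[xv vy] ->] := chord_mean_value (T u) xy.
  have := h1 v; rewrite (ltW xv) (ltW vy) => /(_ isT) h2.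
  rewrite ltr_pdivlMr//.
  apply: (@le_lt_trans _ _ ((1 - e') * len x y)); first by rewrite ler_pM2r//; lra.
  apply: (@le_lt_trans _ _ ((1 - e') * (y - x))); first by rewrite ler_pM2l//; lra.
  by rewrite mulrC ltr_pM2l//; lra.
split => //; first by apply: (aux x) => // v; apply: near; lra.
have -> : - k y x = dot (T y) (gamma y - gamma x) / len x y.
  by rewrite /aimcos chord_lenC -mulNr; congr (_ / _); rewrite /dot /=; ring.
by apply: (aux y) => // v; apply: near; lra.
Qed.

(** Intermediate value theorem: [aimcos a] is near 1 just after [a] and near -1 just
before [a + L]. *)
Lemma aimcos_surj a (v : R) : -1 < v < 1 -> exists2 b, a < b < a + L & k a b = v.
Proof.
move=> /andP[v0 v1].
have e0 : 0 < Num.min (1 - v) (1 + v) by rewrite lt_min; apply/andP; split; lra.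
have [d d0 hd] := near_diagonal a e0; have [d' d'0 hd'] := near_diagonal (a + L) e0.
pose c := Num.min (Num.min (d / 2) (d' / 2)) (L / 3).
have [cd cd' cL] : [/\ c < d, c < d' & c < L / 2].
  split; rewrite /c !gt_min.
  - by have -> : d / 2 < d by lra.
  - by have -> : d' / 2 < d' by [lra]; rewrite orbT.
  - by have -> : L / 3 < L / 2 by [move: L0; lra]; rewrite orbT.
have c0 : 0 < c by rewrite /c !lt_min !divr_gt0.
have [_ h1 _] : [/\ gamma a <> gamma (a + c), v < k a (a + c) & v < - k (a + c) a].
  have [h1 h2 h3] := hd a (a + c) ltac:(lra) ltac:(lra) ltac:(lra).
  have : Num.min (1 - v) (1 + v) <= 1 - v by rewrite ge_min lexx.
  by split => //; lra.
have [_ h2 _] : [/\ gamma (a + L - c) <> gamma (a + L), - v < - k (a + L) (a + L - c) & True].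
  have [h2 h3 h4] := hd' (a + L - c) (a + L) ltac:(lra) ltac:(lra) ltac:(lra).
  have : Num.min (1 - v) (1 + v) <= 1 + v by rewrite ge_min lexx orbT.
  by split => //; lra.
have h3 : k a (a + L - c) < v.
  by rewrite (@aimcos_eq a _ (a + L) (a + L - c)) ?(bp_periodic hg)//; lra.
have [|||b] := @IVT _ (k a) (a + c) (a + L - c) v.
- lra.
- apply: derivable_within_continuous => t; rewrite in_itv /= => /andP[t1 t2].
  have h : gamma a <> gamma t by apply: gamma_neq; lra.
  by have [] := is_derive_aimcos hg h.
- by rewrite ge_min le_max (ltW h3) (ltW h1) orbT.
by rewrite in_itv /= => /andP[b1 b2] e; exists b => //; lra.
Qed.

End aim_bijection.

(** * The billiard map on chords *)

Section billiard.
Context {R : realType} (D : set (plane R)) (L : R) (gamma : R -> plane R).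
Hypothesis hD : strictly_convex_domain D.
Hypothesis hg : boundary_param D L gamma.
Implicit Types (a b s t : R).

Local Notation T := (tangent gamma).
Local Notation k := (aimcos gamma).
Local Notation len := (chord_len gamma).
Local Notation bmap := (billiard_map L gamma).

Let L0 : 0 < L := bp_length_gt0 hg.

Definition depart a b := acos (k a b).
Definition arrive a b := acos (- k b a).

Lemma depart_itv a b : gamma a <> gamma b -> 0 < depart a b < pi.
Proof.
move=> /(aimcos_itv hD hg)/andP[k1 k2]; rewrite acos_gt0 ?acos_ltpi ?k1 ?k2 ?ltW//.
Qed.

Lemma cos_depart a b : gamma a <> gamma b -> cos (depart a b) = k a b.
Proof.
by move=> /(aimcos_itv hD hg)/andP[k1 k2]; rewrite acosK// in_itv /= !ltW.
Qed.

Lemma sin_depart a b : gamma a <> gamma b -> sin (depart a b) = aimsin gamma a b.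
Proof.
move=> ab; have /andP[k1 k2] := aimcos_itv hD hg ab.
by rewrite sin_acos ?(aimsinE hD hg)// !ltW.
Qed.

Lemma arriveE a b : gamma a <> gamma b -> arrive a b = pi - depart b a.
Proof.
move=> ab; have /(aimcos_itv hD hg)/andP[k1 k2] : gamma b <> gamma a by move=> /esym.
by rewrite /arrive acosN// !ltW.
Qed.

Lemma arrive_itv a b : gamma a <> gamma b -> 0 < arrive a b < pi.
Proof.
move=> ab; have ba : gamma b <> gamma a by move=> /esym.
by rewrite arriveE//; have := depart_itv ba; lra.
Qed.

Lemma cos_arrive a b : gamma a <> gamma b -> cos (arrive a b) = - k b a.
Proof.
move=> ab; have /(aimcos_itv hD hg)/andP[k1 k2] : gamma b <> gamma a by move=> /esym.
by rewrite acosK// in_itv /=; apply/andP; split; lra.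
Qed.

Lemma sin_arrive a b : gamma a <> gamma b -> sin (arrive a b) = aimsin gamma b a.
Proof.
move=> ab; have ba : gamma b <> gamma a by move=> /esym.
by rewrite arriveE// sinB sinpi cospi mul0r sub0r mulN1r opprK sin_depart.
Qed.

(** The right-hand side is the unit vector along the chord, so this identifies the
phase point that sets out along it. *)
Lemma direction_chord s s' : gamma s <> gamma s' ->
  direction gamma (s, depart s s') = (len s s')^-1 *: (gamma s' - gamma s).
Proof.
move=> ss; rewrite /direction /= cos_depart// sin_depart//.
rewrite [X in _ = _ *: X](frameE _ (bp_unit_speed hg s)) scalerDr !scalerA.
by rewrite /aimcos /aimsin ![_ / len _ _]mulrC.
Qed.

Lemma direction_arrive s s' : gamma s <> gamma s' ->
  direction gamma (s', arrive s s') =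
  reflect_at gamma s' ((len s s')^-1 *: (gamma s' - gamma s)).
Proof.
move=> ss; rewrite /reflect_at.
set v := _^-1 *: _.
have Dv : dot (T s') v = - k s' s.
  by rewrite /v /aimcos chord_lenC /dot /= /GRing.scale /=; ring.
have Cv : cross (T s') v = - aimsin gamma s' s.
  by rewrite /v /aimsin chord_lenC /cross /= /GRing.scale /=; ring.
have -> : dot (normal gamma s') v = cross (T s') v.
  by rewrite /dot /normal /rot90 /cross /=; ring.
rewrite [X in X - _](frameE v (bp_unit_speed hg s')) Dv Cv /direction cos_arrive// sin_arrive//.
rewrite -addrA -scalerBl; congr (_ + _ *: _); ring.
Qed.

(** Another point of the curve on the same ray would give a chord with the same
cosine at [s], which [aimcos_inj] excludes. *)
Lemma next_point_chord s s' : gamma s <> gamma s' ->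
  next_point gamma (gamma s) ((len s s')^-1 *: (gamma s' - gamma s)) = gamma s'.
Proof.
move=> ss; rewrite /next_point.
have l0 := chord_len_gt0 ss.
suff -> : [set t | 0 < t /\ range gamma (gamma s + t *: ((len s s')^-1 *: (gamma s' - gamma s)))]
    = [set len s s'].
  by rewrite inf1 scalerA divff ?gt_eqF// scale1r addrC subrK.
apply/seteqP; split => t /=; last first.
  move=> ->; split => //; exists s' => //.
  by rewrite scalerA divff ?gt_eqF// scale1r addrC subrK.
move=> [t0 [r _ er]].
(* Any other impact [gamma r] of the ray is [c] times as far as [gamma s']. *)
set c := t / len s s'.
have c0 : 0 < c by rewrite divr_gt0.
have er' : gamma r - gamma s = c *: (gamma s' - gamma s).
  by rewrite er scalerA addrAC subrr add0r.
have sr : gamma s <> gamma r.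
  move=> e; move: er'; rewrite e subrr => /esym/eqP; rewrite scaler_eq0 gt_eqF//=.
  by rewrite subr_eq0 -e eq_sym => /eqP.
have lr : len s r = c * len s s'.
  rewrite /chord_len er'.
  have -> : dot (c *: (gamma s' - gamma s)) (c *: (gamma s' - gamma s)) =
      c ^+ 2 * dot (gamma s' - gamma s) (gamma s' - gamma s).
    by rewrite /dot /= /GRing.scale /=; ring.
  by rewrite sqrtrM ?sqr_ge0// sqrtr_sqr gtr0_norm.
have kr : k s r = k s s'.
  rewrite /aimcos er' lr.
  have -> : dot (T s) (c *: (gamma s' - gamma s)) = c * dot (T s) (gamma s' - gamma s).
    by rewrite /dot /= /GRing.scale /=; ring.
  by field; rewrite !gt_eqF.
have e := aimcos_inj hD hg sr ss kr.
move: lr; rewrite /chord_len e -/(chord_len gamma s s') => /esym.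
by rewrite /c divfK// gt_eqF.
Qed.

(** The ray along the chord meets the curve only once more, and a direction
determines its angle in [0, pi]; so the infimum and the choice in the
definition of the billiard map have these values. *)
Lemma billiard_map_chord s s' : 0 <= s < L -> 0 <= s' < L -> gamma s <> gamma s' ->
  bmap (s, depart s s') = (s', arrive s s').
Proof.
move=> hs hs' ss; rewrite /billiard_map /= depart_itv//.
rewrite direction_chord// next_point_chord//.
apply: xget_unique.
  have /andP[a0 a1] := arrive_itv ss.
  split => //=; last by rewrite direction_arrive.
  by split => /=; rewrite in_itv /= ?(ltW a0) ?(ltW a1).
move=> [r u] [[/= +]]; rewrite !in_itv /= => hr hu er.
have rE : r = s' by apply: (bp_simple hg); rewrite ?inE ?in_itv.
rewrite rE -direction_arrive// => eu; congr (_, _).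
have /andP[a0 a1] := arrive_itv ss.
have aux w : dot (T s') (direction gamma (s', w)) = cos w.
  have := bp_unit_speed hg s'; rewrite /direction /normal /rot90 /dot /= /GRing.scale /= => T1.
  by rewrite -[RHS]mulr1 -T1; ring.
have ec : cos u = cos (arrive s s') by rewrite -!aux eu.
by apply: cos_inj ec; rewrite in_itv /= ?hu ?(ltW a0) ?(ltW a1).
Qed.

Lemma fundamental_point s : exists s', 0 <= s' < L /\ gamma s' = gamma s.
Proof.
have [n hn] := fundamental_rep hg s.
by exists (s + n%:~R * L); rewrite (gamma_periodic hg).
Qed.

Lemma depart_surj s u : 0 < u < pi -> exists s', [/\ 0 <= s' < L, gamma s <> gamma s' & u = depart s s'].
Proof.
move=> /andP[u0 upi].
have h : -1 < cos u < 1.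
  rewrite -cospi -cos0 !ltr_cos ?in_itv /= ?lexx ?pi_ge0 ?(ltW u0) ?(ltW upi) ?u0 ?upi//.
have [b hb e] := aimcos_surj hg s h.
have [s' [hs' es']] := fundamental_point b.
exists s'; split => //; first by rewrite es'; apply: (gamma_neq hg); exact: hb.
rewrite /depart (@aimcos_eq _ _ _ _ hg s s' s b)// e cosK// in_itv /=.
by rewrite !ltW.
Qed.

Lemma billiard_phase x : phase_space L x -> phase_space L (bmap x).
Proof.
case: x => s u; move=> [/=]; rewrite !in_itv /= => hs hu.
have [hu'|] := boolP (0 < u < pi); last first.
  by rewrite /billiard_map /= => /negPf ->; split; rewrite /= in_itv.
have [s' [hs' ss ->]] := depart_surj s hu'.
rewrite billiard_map_chord//; have /andP[a0 a1] := arrive_itv ss.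
by split; rewrite /= in_itv /= ?(ltW a0) ?(ltW a1).
Qed.

Lemma aim_chord s s' : 0 <= s < L -> 0 <= s' < L -> gamma s <> gamma s' ->
  aim L gamma s s' = depart s s'.
Proof.
move=> hs hs' ss; apply: xget_unique.
  by split; [exact: depart_itv|rewrite billiard_map_chord].
move=> u [/(depart_surj s)[r [hr sr ->]]]; rewrite billiard_map_chord//= => e.
by rewrite e.
Qed.

Lemma depart_eq a b a' b' : gamma a = gamma a' -> gamma b = gamma b' ->
  depart a b = depart a' b'.
Proof. by move=> ea eb; rewrite /depart (aimcos_eq hg ea eb). Qed.

Lemma arrive_eq a b a' b' : gamma a = gamma a' -> gamma b = gamma b' ->
  arrive a b = arrive a' b'.
Proof. by move=> ea eb; rewrite /arrive (aimcos_eq hg eb ea). Qed.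

(** On the lift of the circle to ]s, s + L[ the position of impact is the inverse
function of [depart s]. *)
Lemma hit_lift_depart s b : 0 <= s < L -> s < b < s + L ->
  hit_lift L gamma s (depart s b) = b.
Proof.
move=> hs hb; have ne : gamma s <> gamma b by apply: (gamma_neq hg).
rewrite /hit_lift; have [bL|Lb] := ltP b L.
  rewrite billiard_map_chord//=; last by lra.
  by rewrite ltNge; have -> : s <= b by lra.
have eb : gamma b = gamma (b - L) by rewrite -[in LHS](subrK L b) (bp_periodic hg).
rewrite (depart_eq (erefl (gamma s)) eb) billiard_map_chord//=.
- by have -> : b - L < s by [lra]; rewrite subrK.
- by lra.
- by rewrite -eb.
Qed.

Lemma is_derive_depart s b : gamma s <> gamma b ->
  is_derive b 1 (depart s) (aimsin gamma b s / len s b).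
Proof.
move=> sb; have dk := is_derive_aimcos hg sb.
have := is_derive1_comp (is_derive1_acos (aimcos_itv hD hg sb)) dk.
move=> /is_derive_eq; apply; rewrite -(aimsinE hD hg sb) /chord_density.
have s0 : aimsin gamma s b != 0 by rewrite gt_eqF// (aimsin_gt0 hD hg).
by field; rewrite s0 chord_len_neq0.
Qed.

(** The inverse function theorem for [hit_lift], whose inverse is [depart s], gives
the derivative of [depart s]; it is carried out at the representative [b] of
[s'] in ]s, s + L[. *)
Lemma aim_derivE s s' : 0 <= s < L -> 0 <= s' < L -> gamma s <> gamma s' ->
  aim_deriv L gamma s s' = aimsin gamma s' s / len s s'.
Proof.
move=> hs hs' ss; rewrite /aim_deriv aim_chord//.
have [b [/andP[sb bs] eb]] := chord_rep hg ss.
have ne : gamma s <> gamma b by rewrite eb.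
have s's : gamma s' <> gamma s by move=> /esym.
have l0 : 0 < aimsin gamma s' s / len s s'.
  by rewrite divr_gt0 ?chord_len_gt0// (aimsin_gt0 hD hg).
have d : is_derive b 1 (depart s) (aimsin gamma s' s / len s s').
  apply: is_derive_eq (is_derive_depart ne) _.
  by rewrite (aimsin_eq hg eb (erefl (gamma s))) /chord_len eb.
have nb : \forall t \near b, s < t < s + L.
  near=> t; apply/andP; split; near: t; [exact: lt_nbhsr|exact: lt_nbhsl].
have can : {near b, cancel (depart s) (hit_lift L gamma s)}.
  by apply: filterS nb => t ht; exact: hit_lift_depart.
have cont : \forall t \near b, {for t, continuous (depart s)}.
  apply: filterS nb => t ht; apply: differentiable_continuous; apply/derivable1_diffP.
  by have [] := is_derive_depart (gamma_neq hg ht).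
have := is_derive_inverse can cont d; rewrite gt_eqF// => /(_ isT).
rewrite (depart_eq (erefl (gamma s)) eb) => -[_ e].
by rewrite derive1E e gtr0_norm ?invr_gt0// invrK.
Unshelve. all: by end_near.
Qed.

End billiard.

(** * Lower bounds for the transition densities *)

Section lower_integral.
Import HBNNSimple.
Context d (X : measurableType d) (R : realType) (mu : {measure set X -> \bar R}).

(** The integral of a nonnegative function is the supremum of the integrals of the
simple functions below it, and [c] times the indicator of [A] is one of them.
This bounds the integrals of the densities [p n], which are known to be
nonnegative and bounded below, but whose sections come with no measurability. *)
Lemma le_integral_of_le_on (M A : set X) (f : X -> \bar R) (c : R) :
  measurable A -> A `<=` M -> 0 <= c ->
  (forall x, M x -> (0 <= f x)%E) -> (forall x, A x -> (c%:E <= f x)%E) ->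
  (c%:E * mu A <= \int[mu]_(x in M) f x)%E.
Proof.
move=> mA AM c0 f0 fc; rewrite ge0_integralE//.
pose h := scale_nnsfun (indic_nnsfun R mA) c0.
have -> : (c%:E * mu A = sintegral mu h)%E.
  by rewrite sintegralrM sintegral_indic.
apply: ereal_sup_ubound; exists h => //= x.
rewrite mindicE /patch; have [/set_mem Ax|nAx] := boolP (x \in A).
  by rewrite mulr1 mem_set; [exact: fc|exact: AM].
by rewrite mulr0; case: ifPn => // /set_mem; exact: f0.
Qed.
End lower_integral.

Section density.
Context {R : realType} (D : set (plane R)) (L : R) (gamma : R -> plane R).
Hypothesis hD : strictly_convex_domain D.
Hypothesis hg : boundary_param D L gamma.
Variables (eps : R) (p : nat -> R * R -> R * R -> \bar R).
Hypothesis heps : 0 < eps < pi / 2.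
Hypothesis hp : step_density L gamma eps p.
Implicit Types (a b s t u v : R) (x y z : R * R).

Local Notation T := (billiard_map L gamma).
Local Notation M := (phase_space L).

(** Clamping moves [v] away from 0 or pi to the center of a window contained in
[0, pi], so no angle within [eps] of [v] is lost. *)
Lemma clamp_near u v : 0 <= u <= pi -> 0 <= v <= pi -> `|u - v| <= eps ->
  `|u - clamp eps v| <= eps.
Proof.
rewrite !ler_norml /clamp => hu hv huv.
by have [h1|h1] := lerP v eps;
  [have [h2|h2] := lerP eps (pi - eps)|have [h2|h2] := lerP v (pi - eps)]; lra.
Qed.

Lemma phase_spaceP x : M x <-> 0 <= x.1 < L /\ 0 <= x.2 <= pi.
Proof. by rewrite /phase_space /= !in_itv /=. Qed.

Lemma p_ge0 n x y : (2 <= n)%N -> M x -> M y -> (0 <= p n x y)%E.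
Proof.
elim: n x => // -[//|[|n]] IH x _ Mx My.
  rewrite (sd_two hp)// /density2; case: ifPn => // _.
  rewrite lee_fin; do 2 apply: mulr_ge0 => //; apply: mulr_ge0.
    by rewrite invr_ge0 mulr_ge0// sqr_ge0.
  by rewrite invr_ge0.
rewrite (sd_succ hp)//; apply: integral_ge0 => z Mz; exact: IH.
Qed.

(** Within the two noise windows the two-step density is the jacobian
[aim_deriv], a continuous positive function of the chord from the position of
[T x] to that of [y]. *)
Lemma p2_chord x y : M x -> M y -> gamma (T x).1 <> gamma y.1 ->
  `|depart gamma (T x).1 y.1 - (T x).2| <= eps ->
  `|y.2 - arrive gamma (T x).1 y.1| <= eps ->
  p 2%N x y = ((4 * eps ^+ 2)^-1 *
     (aimsin gamma y.1 (T x).1 / chord_len gamma (T x).1 y.1))%:E.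
Proof.
move=> Mx My ne hd ha; rewrite (sd_two hp)// /density2.
have /phase_spaceP[h1 h2] := billiard_phase hD hg Mx.
have /phase_spaceP[h3 h4] := My.
rewrite ifF; last by apply/eqP => e; apply: ne; rewrite e.
rewrite (aim_chord hD hg)// (billiard_map_chord hD hg)//= (aim_derivE hD hg)//.
have /andP[d1 d2] := depart_itv hD hg ne.
have /andP[a1 a2] := arrive_itv hD hg ne.
by rewrite !clamp_near ?mulr1// ?h2 ?(ltW d1) ?(ltW d2) ?(ltW a1) ?(ltW a2).
Qed.

(** One step from [x] is uniform on a window of the fibre above the position of
[T x]; the bound integrates over the piece [u1, u2] of this window only. *)
Lemma p_succ_ge n x y u1 u2 c : (2 <= n)%N -> M x -> M y -> 0 <= c ->
  0 <= u1 -> u1 <= u2 -> u2 <= pi -> (T x).2 - eps <= u1 -> u2 <= (T x).2 + eps ->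
  (forall u, u1 <= u <= u2 -> (c%:E <= p n ((T x).1, u) y)%E) ->
  ((c * ((2 * eps)^-1 * (u2 - u1)))%:E <= p n.+1 x y)%E.
Proof.
move=> n2 Mx My c0 u10 u12 u2pi hu1 hu2 hc.
rewrite (sd_succ hp)//.
have /phase_spaceP[h1 h2] := billiard_phase hD hg Mx.
pose A : set (R * R) := [set (T x).1] `*` `[u1, u2]%classic.
have mA : measurable A by apply: measurableX => //; exact: measurable_itv.
have AM : A `<=` M.
  move=> [z1 z2] [/= ->]; rewrite in_itv /= => /andP[z3 z4].
  by apply/phase_spaceP => /=; split => //; lra.
have -> : ((c * ((2 * eps)^-1 * (u2 - u1)))%:E = c%:E * transition L gamma eps x A)%E.
  rewrite EFinM; congr (_ * _)%E.
  rewrite /transition /noise.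
  have e1 u : \1_A ((T x).1, u) = \1_(`[u1, u2]%classic) u :> R.
    rewrite !indicE; congr (nat_of_bool _)%:R.
    apply/idP/idP => /set_mem h; apply/mem_set; first by case: h.
    by split.
  under eq_integral do rewrite e1.
  have mW : measurable (noise_window eps (T x).2) by exact: measurable_itv.
  have mJ : measurable (`[u1, u2]%classic : set R) by exact: measurable_itv.
  have /= -> // := @integralZl_indic _ _ _ (@lebesgue_measure R) _ mW
    (fun=> `[u1, u2]%classic) (2 * eps)^-1 _ mJ; last first.
    by rewrite invr_lt0 => h; exfalso; move: heps h => /andP[e0 _]; lra.
  rewrite integral_indic//= EFinM; congr (_ * _)%E.
  rewrite (_ : _ `&` _ = `[u1, u2]%classic).
    rewrite lebesgue_measure_itv /= lte_fin.
    have [lt|lt|->] := ltgtP u1 u2; rewrite ?subrr// ?EFinB//.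
    by move: u12; rewrite leNgt lt.
  apply/setIidPl => u; rewrite /noise_window /= !in_itv /= => /andP[uu1 uu2].
  have : `|u - clamp eps (T x).2| <= eps.
    by apply: clamp_near => //; rewrite ?ler_norml; lra.
  by rewrite ler_norml; lra.
apply: le_integral_of_le_on => // z Mz; first exact: p_ge0.
by case: z Mz => z1 z2 [/= ->]; rewrite in_itv /= => /hc.
Qed.

End density.

(** * Local lower bounds along chains of chords *)

Section minorization.
Context {R : realType} (D : set (plane R)) (L : R) (gamma : R -> plane R).
Hypothesis hD : strictly_convex_domain D.
Hypothesis hg : boundary_param D L gamma.
Variables (eps : R) (p : nat -> R * R -> R * R -> \bar R).
Hypothesis heps : 0 < eps < pi / 2.
Hypothesis hp : step_density L gamma eps p.
Implicit Types (a b s t u v : R) (x y z : R * R).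

Local Notation T := (billiard_map L gamma).
Local Notation M := (phase_space L).
Local Notation depart := (depart gamma).
Local Notation arrive := (arrive gamma).

Section limits.
Context {I : Type} {F : set_system I} {FF : Filter F} {f g : I -> R} {a b : R}.
Hypotheses (fa : f x @[x --> F] --> a) (gb : g x @[x --> F] --> b).
Hypothesis ab : gamma a <> gamma b.

Lemma cvg_depart : depart (f x) (g x) @[x --> F] --> depart a b.
Proof.
apply: (cvg_comp _ (@acos R) (cvg_aimcos hg fa gb ab)).
exact: continuous_acos (aimcos_itv hD hg ab).
Qed.

Lemma cvg_arrive : arrive (f x) (g x) @[x --> F] --> arrive a b.
Proof.
have ba : gamma b <> gamma a by move=> /esym.
apply: (cvg_comp _ (@acos R) (cvgN (cvg_aimcos hg gb fa ba))).
apply: continuous_acos; have := aimcos_itv hD hg ba; lra.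
Qed.
End limits.

(** The densities depend on [x] through [T x], and [q.1] stands for [T x].
Positions are compared as points of the curve, so that [q] ranges over an open
set although representatives in [0, L[ jump at [gamma 0]. *)
Definition density_ge n (c : R) (q : (R * R) * (R * R)) := forall x y,
  M x -> M y -> gamma (T x).1 = gamma q.1.1 -> (T x).2 = q.1.2 ->
  gamma y.1 = gamma q.2.1 -> y.2 = q.2.2 -> (c%:E <= p n x y)%E.

Definition minorized n (q : (R * R) * (R * R)) :=
  exists2 c, 0 < c & \forall q' \near q, density_ge n c q'.

(** The density is a continuous positive function of the chord from [s] to [t] as
long as this chord stays inside the two noise windows, which is an open
condition. *)
Lemma minorized2 s v t w : gamma s <> gamma t ->
  `|depart s t - v| < eps -> `|w - arrive s t| < eps ->
  minorized 2 ((s, v), (t, w)).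
Proof.
move=> st hv hw.
have ts : gamma t <> gamma s by move=> /esym.
pose phi s t := (4 * eps ^+ 2)^-1 * (aimsin gamma t s / chord_len gamma s t).
have phi0 : 0 < phi s t.
  rewrite /phi mulr_gt0//.
    by rewrite invr_gt0 mulr_gt0// exprn_gt0//; have := heps; lra.
  by rewrite divr_gt0 ?chord_len_gt0// (aimsin_gt0 hD hg).
exists (phi s t / 2); first by rewrite divr_gt0.
set q0 : (R * R) * (R * R) := ((s, v), (t, w)).
have c1 : (fun q : (R * R) * (R * R) => q.1.1) q @[q --> q0] --> s.
  by apply: (cvg_comp fst fst); [exact: cvg_fst|exact: cvg_fst].
have c2 : (fun q : (R * R) * (R * R) => q.1.2) q @[q --> q0] --> v.
  by apply: (cvg_comp fst snd); [exact: cvg_fst|exact: cvg_snd].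
have c3 : (fun q : (R * R) * (R * R) => q.2.1) q @[q --> q0] --> t.
  by apply: (cvg_comp snd fst); [exact: cvg_snd|exact: cvg_fst].
have c4 : (fun q : (R * R) * (R * R) => q.2.2) q @[q --> q0] --> w.
  by apply: (cvg_comp snd snd); [exact: cvg_snd|exact: cvg_snd].
have n1 := near_chord hg c1 c3 st.
have n2 : \forall q \near q0, `|depart q.1.1 q.2.1 - q.1.2| < eps.
  exact: (cvg_norm (cvgB (cvg_depart c1 c3 st) c2) (lt_nbhsl hv)).
have n3 : \forall q \near q0, `|q.2.2 - arrive q.1.1 q.2.1| < eps.
  exact: (cvg_norm (cvgB c4 (cvg_arrive c1 c3 st)) (lt_nbhsl hw)).
have n4 : \forall q \near q0, phi s t / 2 < phi q.1.1 q.2.1.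
  have hlt : phi s t / 2 < phi s t by lra.
  exact: (cvgM (cvg_cst (4 * eps ^+ 2)^-1)
    (cvgM (cvg_aimsin hg c3 c1 ts) (cvg_chord_lenV hg c1 c3 st)) (lt_nbhsr hlt)).
near=> q => x y Mx My e1 e2 e3 e4.
have ne : gamma (T x).1 <> gamma y.1 by rewrite e1 e3; near: q; exact: n1.
rewrite (p2_chord hD hg hp)//.
- rewrite lee_fin (aimsin_eq hg e3 e1) /chord_len e1 e3 -/(chord_len gamma _ _).
  by apply/ltW; rewrite -/(phi q.1.1 q.2.1); near: q; exact: n4.
- by rewrite (depart_eq hg e1 e3) e2; apply/ltW; near: q; exact: n2.
- by rewrite (arrive_eq hg e1 e3) e4; apply/ltW; near: q; exact: n3.
Unshelve. all: by end_near.
Qed.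

Lemma depart_incr s t1 t2 : t1 < t2 ->
  (forall t, t1 <= t <= t2 -> gamma s <> gamma t) -> depart s t1 < depart s t2.
Proof.
move=> t12 h; have k12 := aimcos_decr hD hg t12 h.
have h1 : gamma s <> gamma t1 by apply: h; lra.
have h2 : gamma s <> gamma t2 by apply: h; lra.
have := depart_itv hD hg h1; have := depart_itv hD hg h2 => d2 d1.
rewrite -ltr_cos ?in_itv /= ?(cos_depart hD hg)//; lra.
Qed.

(** From [(s, v)] the noise reaches all angles near [depart s t].  The interval of
radius [sg] around this angle can be kept fixed while [(s, v)] varies a little,
and all chords that leave with these angles end near [t], arriving nearly like
the chord from [s] to [t], where the [n]-step density is bounded below. *)
Lemma minorizedS n s v t q : (2 <= n)%N -> gamma s <> gamma t ->
  `|depart s t - v| < eps -> minorized n ((t, arrive s t), q) ->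
  minorized n.+1 ((s, v), q).
Proof.
move=> n2 st hv [c c0 [[U V] /= [hU hV] UV]].
have cf : (@fst R R) x @[x --> (s, t)] --> s by exact: cvg_fst.
have cs : (@snd R R) x @[x --> (s, t)] --> t by exact: cvg_snd.
have near1 : \forall x \near (s, t), U (x.2, arrive x.1 x.2) /\ gamma x.1 <> gamma x.2.
  have h1 := near_chord hg cf cs st.
  have h2 := cvg_pair cs (cvg_arrive cf cs st).
  have h3 : \forall x \near (s, t), U (x.2, arrive x.1 x.2) by exact: h2 U hU.
  near=> x; split; near: x; [exact: h3|exact: h1].
have /nbhs_ballP[r /= r0 hr] := near1.
have {}hr s' t' : `|s' - s| < r -> `|t' - t| < r -> U (t', arrive s' t') /\ gamma s' <> gamma t'.
  move=> h1 h2; apply: (hr (s', t')); split => /=; rewrite -ball_normE /= distrC//.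
pose r2 := r / 2; have r20 : 0 < r2 by rewrite divr_gt0.
have r2r : r2 < r by rewrite /r2; lra.
have sch t' : t - r2 <= t' <= t + r2 -> gamma s <> gamma t'.
  by move=> ht'; have [] := hr s t'; rewrite ?subrr ?normr0// ltr_norml; lra.
set u0 := depart s t in hv.
have d1 : depart s (t - r2) < u0 by apply: depart_incr => [|t' ?]; [lra|apply: sch; lra].
have d2 : u0 < depart s (t + r2) by apply: depart_incr => [|t' ?]; [lra|apply: sch; lra].
(* [u0 - sg, u0 + sg] is contained in the window of the noise around [v] and in
     the range of [depart s] on [t - r2, t + r2], with room to move [s] and [v]. *)
pose sg := Num.min (Num.min ((u0 - depart s (t - r2)) / 2) ((depart s (t + r2) - u0) / 2))
  ((eps - `|u0 - v|) / 3).
have [sg1 sg2 sg3] : [/\ sg <= (u0 - depart s (t - r2)) / 2, sg <= (depart s (t + r2) - u0) / 2 &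
    sg <= (eps - `|u0 - v|) / 3].
  by rewrite /sg !ge_min !lexx !orbT.
have sg0 : 0 < sg by rewrite /sg !lt_min !divr_gt0// subr_gt0.
exists (c * ((2 * eps)^-1 * (2 * sg))).
  by rewrite !mulr_gt0// invr_gt0 mulr_gt0//; have := heps; lra.
have ci : (fun x : R => x) x @[x --> s] --> s by exact: cvg_id.
have n1 : \forall s' \near s, depart s' (t - r2) < u0 - sg.
  have h : gamma s <> gamma (t - r2) by apply: sch; lra.
  have hlt : depart s (t - r2) < u0 - sg by lra.
  exact: (cvg_depart ci (cvg_cst (t - r2)) h (lt_nbhsl hlt)).
have n3 : \forall s' \near s, u0 + sg < depart s' (t + r2).
  have h : gamma s <> gamma (t + r2) by apply: sch; lra.
  have hlt : u0 + sg < depart s (t + r2) by lra.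
  exact: (cvg_depart ci (cvg_cst (t + r2)) h (lt_nbhsr hlt)).
have n4 : \forall s' \near s, `|s' - s| < r.
  by near=> s'; rewrite distrC; near: s'; exact: nbhsx_ballx.
have n5 : \forall v' \near v, `|v' - v| < sg.
  by near=> v'; rewrite distrC; near: v'; exact: nbhsx_ballx.
have n6 : \forall x \near (s, v), [/\ depart x.1 (t - r2) < u0 - sg,
    u0 + sg < depart x.1 (t + r2), `|x.1 - s| < r & `|x.2 - v| < sg].
  exists ([set s' | [/\ depart s' (t - r2) < u0 - sg,
    u0 + sg < depart s' (t + r2) & `|s' - s| < r]], [set v' | `|v' - v| < sg]) => /=.
    split => //; near=> s'; split; near: s'; assumption.
  by move=> [s' v'] [/= [? ? ?] ?].
exists ([set x | [/\ depart x.1 (t - r2) < u0 - sg,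
    u0 + sg < depart x.1 (t + r2), `|x.1 - s| < r & `|x.2 - v| < sg]], V) => //=.
move=> [[s' v'] q'] [/= [h1 h2 h3 h4] Vq'] x y Mx My /= e1 e2 e3 e4.
have Tx := billiard_phase hD hg Mx.
have /phase_spaceP[b1 b2] := Tx.
have c1 : gamma s' <> gamma (t - r2) by have [] := hr s' (t - r2); rewrite // ltr_norml; lra.
have c2 : gamma s' <> gamma (t + r2) by have [] := hr s' (t + r2); rewrite // ltr_norml; lra.
have i1 := depart_itv hD hg c1; have i2 := depart_itv hD hg c2.
clear n1 n3 n4 n5 n6 near1 hU hV d1 d2 sg1 sg2 sch c1 c2.
clearbody sg u0 r2.
move: sg3 h4 hv; rewrite !ltr_norml => sg3 h4 hv.
have h5 : `|u0 - v| < eps by rewrite ltr_norml.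
have h6 := ler_norm (u0 - v).
have -> : 2 * sg = (u0 + sg) - (u0 - sg) by lra.
have h8 : - (u0 - v) <= `|u0 - v| by rewrite ler_normr lexx orbT.
apply: (p_succ_ge hD hg heps hp) => //; rewrite ?e2; [exact: ltW|lra|lra|lra|lra|lra|].
move=> u /andP[u1 u2].
have [|||t'] := @IVT _ (depart s') (t - r2) (t + r2) u.
- lra.
- apply: derivable_within_continuous => t'; rewrite in_itv /= => ht'.
  have [|_ h] := hr s' t' h3; first by rewrite ltr_norml; lra.
  by have [] := is_derive_depart hD hg h.
- rewrite ge_min le_max; apply/andP; split; apply/orP; [left|right]; lra.
rewrite in_itv /= => ht' eu.
have [|Ut' h] := hr s' t' h3; first by rewrite ltr_norml; lra.
have [t0 [ht0 et0]] := fundamental_point hg t'.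
have ne : gamma (T x).1 <> gamma t0 by rewrite e1 et0.
have ex : T ((T x).1, u) = (t0, arrive s' t').
  by rewrite -eu (depart_eq hg (esym e1) (esym et0)) (billiard_map_chord hD hg)// (arrive_eq hg e1 et0).
apply: (UV ((t', arrive s' t'), q')) => //=; rewrite ?ex//=.
by apply/phase_spaceP => /=; split => //; lra.
Unshelve. all: by end_near.
Qed.

End minorization.

(** * Thickening a set of reals; measurability in the plane *)

Section thickening.
Context {R : realType}.
Notation mu := (@lebesgue_measure R).

(** If [x] is at distance at least [d] from [O], then to the right of the supremum
[m] of the part of [O] before [x], the interval ]m, m + d[ misses [O] and is
contained in [V]; it adds [d] to the measure of [O].  This needs a point of [O]
before [x]; the other case is symmetric. *)
Lemma thickening_right (O V : set R) (l r d x o : R) : measurable O -> measurable V ->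
  0 < d -> O `<=` `]l, r[%classic ->
  (forall y u, l < y < r -> O u -> `|y - u| < d -> V y) ->
  (mu V <= mu O)%E -> (mu O < +oo)%E -> O o -> o <= x -> x < r ->
  exists2 u, O u & `|x - u| < d.
Proof.
move=> mO mV d0 Or OV VO Ofin Oo ox xr; apply: contrapT => nu.
have far u : O u -> u <= x -> u <= x - d.
  move=> Ou ux; rewrite leNgt; apply/negP => h; apply: nu; exists u => //.
  by rewrite ger0_norm; lra.
pose A := O `&` [set u | u <= x].
have supA : has_sup A.
  by split; [exists o|exists x => u []].
pose m := sup A.
have om : o <= m by apply: ub_le_sup => //; exact: supA.2.
have mx : m <= x - d by apply: ge_sup => [|u [Ou ux]]; [exists o|exact: far].
have lo : l < o by have := Or _ Oo; rewrite /= in_itv /= => /andP[].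
pose J : set R := `]m, m + d[%classic.
have JV : J `<=` V.
  move=> y; rewrite /J /= in_itv /= => /andP[my ymd].
  have [u [Ou ux] um] : exists2 u, A u & y - d < u.
    have : 0 < m - (y - d) by lra.
    by move=> /(sup_adherent)/(_ supA)[u Au]; rewrite -/m => h; exists u => //; lra.
  have : u <= m by apply: ub_le_sup; [exact: supA.2|split].
  move=> um'; apply: (OV y u) => //; [lra|rewrite ger0_norm; lra].
have OVs : O `<=` V.
  move=> y Oy; apply: (OV y y) => //; last by rewrite subrr normr0.
  by have := Or _ Oy; rewrite /= in_itv.
(* A point of [O] in [J] would be before [x], as [m + d <= x], hence at most [m]. *)
have dis : O `&` J = set0.
  apply/seteqP; split => // y [Oy]; rewrite /J /= in_itv /= => /andP[my ymd].
  have : y <= m; last lra.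
  by apply: ub_le_sup; [exact: supA.2|split => //=; lra].
have muJ : mu J = d%:E.
  by rewrite /J lebesgue_measure_itv /= lte_fin ltrDl d0 -EFinD addrAC subrr add0r.
have : (mu (O `|` J) <= mu O)%E.
  apply: le_trans VO; apply: le_measure; rewrite ?inE//; last first.
    by move=> y [/OVs|/JV].
  by apply: measurableU => //; exact: measurable_itv.
have -> : mu (O `|` J) = (mu O + d%:E)%E.
  by rewrite -muJ; apply: measureU => //; exact: measurable_itv.
have : mu O \is a fin_num by rewrite ge0_fin_numE.
by move: (mu O) => [a| |]//= _; rewrite -EFinD lee_fin; lra.
Qed.

Lemma measurable_opp_set (A : set R) : measurable A -> measurable (-%R @` A).
Proof.
move=> mA; have -> : -%R @` A = (-%R : R -> R) @^-1` A.
  apply/seteqP; split => [_ [y Ay <-] /=|y /= Ay]; first by rewrite opprK.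
  by exists (- y) => //; rewrite opprK.
have : measurable_fun setT (-%R : R -> R) by exact: oppr_measurable.
by move=> /(_ measurableT _ mA); rewrite setTI.
Qed.

Lemma lebesgue_measure_opp (A : set R) : measurable A -> mu (-%R @` A) = mu A.
Proof.
move=> mA; rewrite -[RHS]lebesgue_measureN// /pushforward; congr (mu _).
apply/seteqP; split => [_ [y Ay <-] /=|y /= Ay]; first by rewrite opprK.
by exists (- y) => //; rewrite opprK.
Qed.

(** A set that gains no measure when it is thickened by [d] inside an interval is
empty or [d]-dense in the interval. *)
Lemma thickening_full (O V : set R) (l r d : R) : measurable O -> measurable V ->
  0 < d -> O !=set0 -> O `<=` `]l, r[%classic ->
  (forall y u, l < y < r -> O u -> `|y - u| < d -> V y) ->
  (mu V <= mu O)%E -> (mu O < +oo)%E ->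
  forall x, l < x < r -> exists2 u, O u & `|x - u| < d.
Proof.
move=> mO mV d0 [u0 Ou0] hOr OV VO Ofin x /andP[lx xr].
have [ux|xu] := leP u0 x; first exact: (thickening_right mO mV d0 hOr OV VO Ofin Ou0 ux xr).
have [| | | | | | | | | |z [u Ou <-] hu] := @thickening_right (-%R @` O) (-%R @` V) (- r) (- l) d (- x) (- u0).
- exact: measurable_opp_set.
- exact: measurable_opp_set.
- exact: d0.
- by move=> z [y /hOr h <-]; move: h; rewrite /= !in_itv /=; lra.
- move=> y _ h [u Ou <-] hy.
  exists (- y); last by rewrite opprK.
  apply: (OV _ u) => //; first lra.
  by move: hy; rewrite -normrN; congr (`|_| < _); ring.
- by rewrite !lebesgue_measure_opp.
- by rewrite lebesgue_measure_opp.
- by exists u0.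
- lra.
- lra.
by exists u => //; move: hu; rewrite -normrN; congr (`|_| < _); ring.
Qed.

Lemma open_measurable2 (U : set (R * R)) : open U -> measurable U.
Proof.
move=> oU.
pose box (q1 q2 : rat) (n : nat) : set (R * R) :=
  `]ratr q1 - n.+1%:R^-1, ratr q1 + n.+1%:R^-1[%classic `*`
  `]ratr q2 - n.+1%:R^-1, ratr q2 + n.+1%:R^-1[%classic.
(* An open set of the plane is a countable union of boxes with rational centers. *)
pose B q1 q2 n := if `[< box q1 q2 n `<=` U >] then box q1 q2 n else set0.
have -> : U = \bigcup_q1 \bigcup_q2 \bigcup_n B q1 q2 n.
  apply/seteqP; split => [[x y] Uxy|z [q1 _ [q2 _ [n _]]]]; last first.
    by rewrite /B; case: ifPn => // /asboolP; exact.
  have /nbhs_ballP[r /= r0 hr] := oU _ Uxy.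
  have [n nr] : exists n, (n.+1%:R^-1 < r / 2 :> R).
    have r2 : 0 < r / 2 by lra.
    have [n _ hn] := near_infty_natSinv_lt (PosNum r2).
    by exists n; exact: (hn n (leqnn n)).
  have n0 : 0 < n.+1%:R^-1 :> R by rewrite invr_gt0.
  have around (z : R) : z - n.+1%:R^-1 < z + n.+1%:R^-1.
    by rewrite ltrD2l gt0_cp.
  have [q1 hq1] := rat_in_itvoo (around x).
  have [q2 hq2] := rat_in_itvoo (around y).
  move: hq1 hq2; rewrite !in_itv /= => hq1 hq2.
  exists q1 => //; exists q2 => //; exists n => //.
  rewrite /B /box.
  move: (n.+1%:R^-1) n0 nr {around} hq1 hq2 => e e0 er hq1 hq2.
  rewrite ifT; first by split; rewrite /= in_itv /=; lra.
  apply/asboolP => -[z1 z2] [/=]; rewrite !in_itv /= => h1 h2.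
  by apply: hr; split; rewrite -ball_normE /= ltr_norml; lra.
apply: bigcupT_measurable_rat => q1; apply: bigcupT_measurable_rat => q2.
apply: bigcupT_measurable => n; rewrite /B; case: ifPn => // _.
by apply: measurableX; exact: measurable_itv.
Qed.

Lemma open_continuous_measurable_fun2 (U : set (R * R)) (f : R * R -> R) :
  open U -> (forall x, U x -> {for x, continuous f}) -> measurable_fun U f.
Proof.
move=> oU cf; apply: (measurability _ (RGenOpens.measurableE R)).
move=> _ [_ [a [b ->] <-]]; apply: open_measurable2.
rewrite openE => x [Ux fx]; apply: filterI; first exact: oU.
apply: (cf _ Ux); have : open (`]a, b[%classic : set R) by exact: interval_open.
by apply.
Qed.

End thickening.

(** * Change of variables for a set *)

Section change_of_variables.
Context {R : realType}.
Notation mu := (@lebesgue_measure R).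
Variables (h rho : R -> R).

Section compact.
Variables (p q : R).
Hypothesis pq : p < q.
Hypothesis dh : forall x, p <= x <= q -> is_derive x 1 h (rho x).
Hypothesis crho : forall x, p <= x <= q -> {for x, continuous rho}.
Hypothesis rho0 : forall x, p <= x <= q -> 0 < rho x.

Let hcont : {within `[p, q], continuous h}.
Proof.
apply: derivable_within_continuous => x; rewrite in_itv /= => xpq.
by have [] := dh xpq.
Qed.

Let hincr x y : p <= x -> x < y -> y <= q -> h x < h y.
Proof.
move=> px xy yq; apply: (is_derive_gt0_lt (dh := rho) xy) => z hz.
- by apply: dh; lra.
- by apply: rho0; lra.
Qed.

Let mrho : measurable_fun `]p, q]%classic rho.
Proof.
have : measurable_fun (`[p, q]%classic : set R) rho.
  apply: subspace_continuous_measurable_fun; first exact: measurable_itv.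
  apply/continuous_within_itvP => //; split.
  - by move=> x; rewrite in_itv /= => /andP[px xq]; apply: crho; lra.
  - by apply: cvg_at_right_filter; apply: (@crho p); rewrite lexx ltW.
  - by apply: cvg_at_left_filter; apply: (@crho q); rewrite lexx ltW.
by apply: measurable_funS => //; apply: subset_itvr; rewrite bnd_simp.
Qed.

Let mh : measurable_fun `]p, q]%classic h.
Proof.
have : measurable_fun (`[p, q]%classic : set R) h.
  by apply: subspace_continuous_measurable_fun; [exact: measurable_itv|exact: hcont].
by apply: measurable_funS => //; apply: subset_itvr; rewrite bnd_simp.
Qed.

(** The measure that has to be recognized as Lebesgue measure on the range of [h];
it is enough to compare the two on intervals. *)
Definition pulled_back (X : set (measurableTypeR R)) : \bar R :=
  (\int[mu]_(x in `]p, q]%classic) (rho x * \1_X (h x))%:E)%E.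

Let mpull (X : set R) : measurable X ->
  measurable_fun `]p, q]%classic (fun x => (rho x * \1_X (h x))%:E).
Proof.
move=> mX; apply/measurable_EFinP; apply: measurable_funM => //.
by apply: measurableT_comp => //; exact: measurable_indic.
Qed.

Let pull_fun_ge0 (X : set R) x : `]p, q]%classic x -> (0 <= (rho x * \1_X (h x))%:E)%E.
Proof.
rewrite /= in_itv /= => /andP[px xq]; rewrite lee_fin mulr_ge0//.
by apply/ltW/rho0; lra.
Qed.

Let pull0 : pulled_back set0 = 0%E.
Proof. by apply: integral0_eq => x _; rewrite indicE in_set0 mulr0. Qed.

Let pull_ge0 X : (0 <= pulled_back X)%E.
Proof. by apply: integral_ge0 => x; exact: pull_fun_ge0. Qed.

Let pull_sigma_additive : semi_sigma_additive pulled_back.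
Proof.
move=> F mF tF mUF; apply: cvg_toP.
  apply: ereal_nondecreasing_is_cvgn => m n mn.
  by apply: lee_sum_nneg_natr => // i _ _; exact: pull_ge0.
rewrite -integral_nneseries //=.
- by apply: eq_integral => u _; rewrite EFinM indic_bigcup // -nneseriesZl.
- move=> n; exact: (mpull (mF n)).
- move=> n x; rewrite inE; exact: pull_fun_ge0.
Qed.

HB.instance Definition _ := isMeasure.Build _ (measurableTypeR R) R
  pulled_back pull0 pull_ge0 pull_sigma_additive.

Let pulled_back_itv x y : pulled_back `]x, y]%classic =
  mu (`]x, y]%classic `&` `]h p, h q]%classic).
Proof.
pose x' := Num.max x (h p); pose y' := Num.min y (h q).
have -> : `]x, y]%classic `&` `]h p, h q]%classic = `]x', y']%classic :> set R.
  apply/seteqP; split => z /=; rewrite !in_itv /= gt_max le_min.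
    by move=> [/andP[-> ->] /andP[-> ->]].
  by move=> /andP[/andP[-> ->] /andP[-> ->]].
have hpq z : p < z <= q -> h p < h z <= h q.
  move=> /andP[pz zq]; rewrite hincr//= le_eqVlt.
  move: zq; rewrite le_eqVlt => /orP[/eqP->|zq]; first by rewrite eqxx.
  by rewrite hincr ?orbT// ltW.
rewrite lebesgue_measure_itv /= lte_fin.
have [xy'|yx'] := ltP x' y'; last first.
  apply: integral0_eq => z; rewrite /= in_itv /= => /hpq /andP[h1 h2].
  rewrite indicE memNset ?mulr0//= in_itv /= => /andP[h3 h4].
  have : x' < y' by apply: (@lt_le_trans _ _ (h z)); rewrite /x' /y' ?gt_max ?le_min ?h1 ?h2 ?h3 ?h4.
  by rewrite ltNge yx'.
have [x'p y'q] : h p <= x' /\ y' <= h q by rewrite le_max ge_min !lexx !orbT.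
have hpq0 : h p < h q by apply: hincr.
(* The end points [x'] and [y'] of the interval, cut off at the range of [h], are
     values of [h], say at [s] and [t]. *)
have ivt z : h p <= z <= h q -> exists2 s, p <= s <= q & h s = z.
  move=> /andP[z1 z2]; have [|||s] := @IVT _ h p q z; [exact: ltW|exact: hcont| |].
    by rewrite ge_min le_max z1 z2 orbT.
  by rewrite in_itv /= => hs e; exists s.
have [s hs es] : exists2 s, p <= s <= q & h s = x' by apply: ivt; lra.
have [t ht et] : exists2 t, p <= t <= q & h t = y' by apply: ivt; lra.
have mono z1 z2 : p <= z1 <= q -> p <= z2 <= q -> (h z1 < h z2) = (z1 < z2).
  move=> /andP[h1 h2] /andP[h3 h4]; case: (ltgtP z1 z2) => [lt|lt|->]; last by rewrite ltxx.
    exact: hincr.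
  by apply/negbTE; rewrite -leNgt ltW// hincr.
have st : s < t by rewrite -mono// es et.
have e1 z : z \in (`]p, q]%classic : set R) ->
    (rho z * \1_(`]x, y]%classic : set R) (h z))%:E =
    ((fun z => (rho z)%:E) \_ `]s, t]%classic) z.
  rewrite inE /= in_itv /= => hz; rewrite indicE patchE.
  have hz' : p <= z <= q by lra.
  have -> : (h z \in `]x, y]%classic) = (z \in (`]s, t]%classic : set R)).
    apply/idP/idP; rewrite !inE /= !in_itv /=.
      move=> /andP[z1 z2]; rewrite -(mono s z)// es leNgt -(mono t z)// et -leNgt.
      by rewrite gt_max le_min z1 z2; have /andP[-> ->] := hpq _ hz.
    rewrite -(mono s z)// es leNgt -(mono t z)// et -leNgt gt_max le_min.
    by move=> /andP[/andP[-> _] /andP[-> _]].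
  by case: ifPn => _; rewrite ?mulr1 ?mulr0.
transitivity (\int[mu]_(z in `]p, q]%classic) ((fun z => (rho z)%:E) \_ `]s, t]%classic) z)%E.
  by apply: eq_integral => z hz; exact: e1.
rewrite -integral_mkcondr.
have -> : `]p, q]%classic `&` `]s, t]%classic = `]s, t]%classic :> set R.
  by apply/setIidr => z /=; rewrite !in_itv /=; lra.
rewrite integral_itv_obnd_cbnd; last first.
  apply/measurable_EFinP; apply: measurable_funS mrho => //.
  by move=> z /=; rewrite !in_itv /=; lra.
rewrite (@continuous_FTC2 _ rho h)//.
- by rewrite es et.
- apply/continuous_within_itvP => //; split.
  + by move=> z; rewrite in_itv /= => hz; apply: crho; lra.
  + by apply: cvg_at_right_filter; apply: (@crho s).
  + by apply: cvg_at_left_filter; apply: (@crho t).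
- have hc z : p <= z <= q -> {for z, continuous h}.
    move=> hz; apply: differentiable_continuous; apply/derivable1_diffP.
    by have [] := dh hz.
  split.
  + by move=> z; rewrite in_itv /= => hz; have [|] := @dh z; first lra.
  + by apply: cvg_at_right_filter; exact: hc.
  + by apply: cvg_at_left_filter; exact: hc.
- move=> z; rewrite in_itv /= => hz; have [|_ e] := @dh z; first lra.
  by rewrite derive1E.
Qed.

Lemma pulled_backE (X : set R) : measurable X ->
  pulled_back X = mu (X `&` `]h p, h q]%classic).
Proof.
move=> mX.
have mhpq : measurable (`]h p, h q]%classic : set (measurableTypeR R)) by exact: measurable_itv.
pose m2 := mrestr mu mhpq.
apply: (@measure_unique _ _ (measurableTypeR R) (@ocitv R) (fun n => `](- n%:R), n%:R]%classic) _ _ _ _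
  (pulled_back : {measure set (measurableTypeR R) -> \bar R}) (m2 : {measure set _ -> \bar R})) => //.
- exact: ocitvI.
- by move=> n; exact: is_ocitv.
- exact: (@bigcup_itvT R false false).
- by move=> _ [[x y] _ <-]; exact: pulled_back_itv.
- move=> n; suff : (pulled_back `](- n%:R)%R, (n%:R)%R]%classic < +oo)%E by [].
  rewrite pulled_back_itv.
  apply: (@le_lt_trans _ _ (mu `]h p, h q]%classic)); last first.
    by rewrite lebesgue_measure_itv; case: ifP; rewrite ?ltry// -EFinB ltry.
  by apply: le_measure; rewrite ?inE//; apply: measurableI; exact: measurable_itv.
Qed.
End compact.

Section opened.
Variables (p q : R).
Hypothesis pq : p < q.
Hypothesis dh : forall x, p < x < q -> is_derive x 1 h (rho x).
Hypothesis crho : forall x, p < x < q -> {for x, continuous rho}.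
Hypothesis rho0 : forall x, p < x < q -> 0 < rho x.

(** The substitution [y = h x] in the measure of an arbitrary measurable set [X]; the
density [rho] may be unbounded at the ends of the interval, hence the
exhaustion by compact intervals. *)
Lemma change_of_variables (X : set R) : measurable X ->
  (\int[mu]_(x in `]p, q[%classic) (rho x * \1_X (h x))%:E)%E =
  mu (X `&` h @` `]p, q[%classic).
Proof.
move=> mX.
(* [n.+3] rather than [n.+1], so that the compact intervals are nondegenerate. *)
pose d (n : nat) := (q - p) / n.+3%:R.
have d0 n : 0 < d n by rewrite divr_gt0// subr_gt0.
have d3 n : d n <= (q - p) / 3.
  by rewrite ler_pM2l ?subr_gt0// lef_pV2 ?posrE// ler_nat.
have dS m n : (m <= n)%N -> d n <= d m.
  by move=> mn; rewrite ler_pM2l ?subr_gt0// lef_pV2 ?posrE// ler_nat.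
have dlt x : 0 < x -> exists n, d n < x.
  move=> x0; have h0 : 0 < x / (q - p) by rewrite divr_gt0// subr_gt0.
  have [n _ hn] := near_infty_natSinv_lt (PosNum h0).
  exists n; have /= := hn n (leqnn n); rewrite ltr_pdivlMr ?subr_gt0// mulrC => h1.
  apply: le_lt_trans h1.
  by rewrite ler_pM2l ?subr_gt0// lef_pV2 ?posrE// ler_nat ltnW.
pose F (n : nat) : set R := `]p + d n, q - d n]%classic.
have UF : \bigcup_n F n = `]p, q[%classic.
  apply/seteqP; split => [x [n _]|x].
    by rewrite /F /= !in_itv /= => h1; have := d0 n; lra.
  rewrite /= in_itv /= => hx.
  have [|n hn] := @dlt (Num.min (x - p) (q - x)).
    by rewrite lt_min !subr_gt0.
  exists n => //; rewrite /F /= in_itv /=; move: hn; rewrite lt_min; lra.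
have mF n : measurable (F n) by exact: measurable_itv.
have ndF : nondecreasing_seq F.
  move=> m n mn; apply/subsetPset => x; rewrite /F /= !in_itv /=.
  by have := dS _ _ mn; lra.
have mono x y : p < x -> x < y -> y < q -> h x < h y.
  move=> px xy yq; apply: (is_derive_gt0_lt (dh := rho) xy) => z hz.
  - by apply: dh; lra.
  - by apply: rho0; lra.
have hcont x : p < x < q -> {for x, continuous h}.
  move=> hx; apply: differentiable_continuous; apply/derivable1_diffP.
  by have [] := dh hx.
have e1 n : (\int[mu]_(x in F n) (rho x * \1_X (h x))%:E)%E =
    mu (X `&` `]h (p + d n), h (q - d n)]%classic).
  have := d3 n; have := d0 n => h1 h2.
  by apply: pulled_backE => // [|x hx|x hx|x hx]; [lra|apply: dh; lra|apply: crho; lra|apply: rho0; lra].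
have imF : \bigcup_n (X `&` `]h (p + d n), h (q - d n)]%classic) =
    X `&` h @` `]p, q[%classic.
  apply/seteqP; split => [y [n _ [Xy]]|y [Xy [x hx xy]]].
    rewrite /= in_itv /= => /andP[y1 y2]; split => //.
    have := d3 n; have := d0 n => h1 h2.
    have [|||x] := @IVT _ h (p + d n) (q - d n) y; first lra.
    - apply: derivable_within_continuous => z; rewrite in_itv /= => zxy.
      by have [|] := @dh z; first lra.
    - by rewrite ge_min le_max (ltW y1) y2 orbT.
    by rewrite in_itv /= => hx e; exists x => //=; rewrite in_itv /=; lra.
  rewrite -xy in Xy *; have : (\bigcup_n F n) x by rewrite UF.
  move=> [n _]; rewrite /F /= in_itv /= => hx'; exists n => //; split => //=.
  move: hx; rewrite /= !in_itv /= => hx; have := d0 n => h1.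
  apply/andP; split; first by apply: mono; lra.
  have /andP[_] := hx'; rewrite le_eqVlt => /orP[/eqP->//|xq].
  by apply/ltW/mono; lra.
have mpull : measurable_fun `]p, q[%classic (fun x => (rho x * \1_X (h x))%:E).
  apply/measurable_EFinP; apply: measurable_funM.
    apply: open_continuous_measurable_fun; first exact: interval_open.
    by move=> x; rewrite inE /= in_itv /= => hx; exact: crho.
  apply: measurableT_comp => //.
  apply: open_continuous_measurable_fun; first exact: interval_open.
  by move=> x; rewrite inE /= in_itv /= => hx; exact: hcont.
have c1 : (\int[mu]_(x in F n) (rho x * \1_X (h x))%:E)%E @[n --> \oo] -->
    (\int[mu]_(x in `]p, q[%classic) (rho x * \1_X (h x))%:E)%E.
  rewrite -UF; apply: ge0_nondecreasing_set_cvg_integral => //.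
    by move=> n; apply: measurable_funS mpull => //; rewrite -UF; exact: bigcup_sup.
  move=> n x; rewrite /F /= in_itv /= => hx; have := d0 n => h1.
  by rewrite lee_fin mulr_ge0//; apply/ltW/rho0; lra.
have mG n : measurable (X `&` `]h (p + d n), h (q - d n)]%classic).
  by apply: measurableI => //; exact: measurable_itv.
have c2 : mu (X `&` `]h (p + d n), h (q - d n)]%classic) @[n --> \oo] -->
    mu (X `&` h @` `]p, q[%classic).
  rewrite -imF; apply: (@nondecreasing_cvg_mu _ _ _ mu) => //.
    exact: bigcupT_measurable.
  move=> m n mn; apply/subsetPset => y [Xy]; rewrite /= !in_itv /= => /andP[y1 y2].
  have := dS _ _ mn; have := d3 m; have := d3 n; have := d0 n; have := d0 m => h1 h2 h3 h4 h5.
  have h6 : (d n == d m) || (d n < d m) by rewrite -le_eqVlt.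
  split => //=; apply/andP; split.
    apply: le_lt_trans y1; case/orP: h6 => [/eqP->//|h7].
    by apply/ltW/mono; lra.
  apply: (le_trans y2); case/orP: h6 => [/eqP->//|h7].
  by apply/ltW/mono; lra.
have c3 : (\int[mu]_(x in F n) (rho x * \1_X (h x))%:E)%E @[n --> \oo] -->
    mu (X `&` h @` `]p, q[%classic).
  by under eq_fun do rewrite e1.
exact: (cvg_unique _ c1 c3).
Qed.

End opened.
End change_of_variables.

(** * Sets of chords that are closed under noisy reflection *)

Section dominated_functions.
Context {R : realType}.
Local Notation mu := (@lebesgue_measure R).
Implicit Types f g : R -> \bar R.

(** Domination by a constant on an interval and by 0 outside. *)
Lemma integral_bounded_lty f (l r M : R) : measurable_fun setT f ->
  (forall x, (0 <= f x)%E) -> (forall x, l < x < r -> (f x <= M%:E)%E) ->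
  (forall x, ~~ (l < x < r) -> f x = 0%E) -> 0 <= M ->
  (\int[mu]_x f x < +oo)%E.
Proof.
move=> mf f0 fM fE M0.
have mI : measurable (`]l, r[%classic : set R) by exact: measurable_itv.
have -> : (\int[mu]_x f x = \int[mu]_(x in `]l, r[%classic) f x)%E.
  rewrite [RHS]integral_mkcond; apply: eq_integral => x _; rewrite patchE.
  case: ifPn => //; rewrite notin_setE /= in_itv /= => /negP; exact: fE.
apply: (@le_lt_trans _ _ (\int[mu]_(x in `]l, r[%classic) (cst M%:E) x)%E).
  by apply: ge0_le_integral => //; exact: measurable_funTS.
rewrite integral_cst//.
suff : (M%:E * mu (`]l, r[%classic : set R) < +oo)%E by [].
rewrite lebesgue_measure_itv /=; case: ifP => _; last by rewrite mule0.
by rewrite -EFinD -EFinM ltry.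
Qed.

Lemma ae_eq_le_integral f g : measurable_fun setT f -> measurable_fun setT g ->
  (forall x, (0 <= f x)%E) -> (forall x, (f x <= g x)%E) ->
  (forall x, g x \is a fin_num) ->
  (\int[mu]_x g x < +oo)%E -> (\int[mu]_x g x = \int[mu]_x f x)%E ->
  {ae mu, forall x, g x = f x}.
Proof.
move=> mf mg f0 fg gfin goo e.
have g0 x : (0 <= g x)%E by apply: le_trans (fg x).
have ffin x : f x \is a fin_num.
  rewrite ge0_fin_numE//; apply: le_lt_trans (fg x) _.
  by rewrite -ge0_fin_numE.
have eabs h : (forall x, (0 <= h x)%E) -> (\int[mu]_x `|h x| = \int[mu]_x h x)%E.
  by move=> h0; apply: eq_integral => x _; rewrite gee0_abs.
have ig : mu.-integrable setT g.
  by apply/integrableP; split; [exact: mg|rewrite eabs].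
have if' : mu.-integrable setT f.
  by apply/integrableP; split; [exact: mf|rewrite eabs// -e].
have mh : measurable_fun setT (g \- f)%E by exact: emeasurable_funB.
have h0 x : (0 <= (g \- f) x)%E by rewrite /= sube_ge0 ?fg// ffin.
have ih : (\int[mu]_x `|(g \- f) x| = 0)%E.
  rewrite eabs// integralB// e subee// ge0_fin_numE; first by rewrite -e.
  exact: integral_ge0.
have := (ae_eq_integral_abs mu measurableT mh).1 ih.
apply: filterS => x /(_ Logic.I) /= /eqP.
by rewrite sube_eq ?add0e ?fin_num_adde_defr// => /eqP.
Qed.

End dominated_functions.

Section transitivity.
Context {R : realType} (D : set (plane R)) (L : R) (gamma : R -> plane R).
Hypothesis hD : strictly_convex_domain D.
Hypothesis hg : boundary_param D L gamma.
Implicit Types (a b c s t : R).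

Local Notation k := (aimcos gamma).
Local Notation mu := (@lebesgue_measure R).

Let L0 : 0 < L := bp_length_gt0 hg.

Lemma continuous_chord_density b a : gamma b <> gamma a ->
  {for a, continuous (chord_density gamma b)}.
Proof.
move=> ba; have ab : gamma a <> gamma b by move=> /esym.
have c1 : x @[x --> a] --> a by exact: cvg_id.
have c2 : (fun=> b) x @[x --> a] --> b by exact: cvg_cst.
exact: cvgM (cvgM (cvg_aimsin hg c2 c1 ba) (cvg_aimsin hg c1 c2 ab)) (cvg_chord_lenV hg c2 c1 ba).
Qed.

(** A strictly monotone continuous function is an open map. *)
Lemma aimcos_image_open b (S : set R) : open S -> S `<=` [set a | gamma b <> gamma a] ->
  open [set - k b a | a in S].
Proof.
move=> oS Sb; rewrite openE => _ [a Sa <-].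
have /nbhs_ballP[r /= r0 hr] := oS _ Sa.
have Sr t : a - r / 2 <= t <= a + r / 2 -> S t.
  by move=> ht; apply: hr; rewrite -ball_normE /= ltr_norml; lra.
have d1 : k b a < k b (a - r / 2).
  by apply: (aimcos_decr hD hg) => [|t ht]; [lra|apply/Sb/Sr; lra].
have d2 : k b (a + r / 2) < k b a.
  by apply: (aimcos_decr hD hg) => [|t ht]; [lra|apply/Sb/Sr; lra].
near=> y.
have y1 : - k b (a - r / 2) < y by near: y; apply: lt_nbhsr; lra.
have y2 : y < - k b (a + r / 2) by near: y; apply: lt_nbhsl; lra.
have [|||t] := @IVT _ (fun x => - k b x) (a - r / 2) (a + r / 2) y; first lra.
- apply: derivable_within_continuous => t; rewrite in_itv /= => ht.
  by have [] := is_derive_opp_aimcos hg (Sb _ (Sr _ ht)).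
- by rewrite ge_min le_max (ltW y1) (ltW y2) orbT.
by rewrite in_itv /= => ht e; exists t => //; exact: Sr.
Unshelve. all: by end_near.
Qed.

(** Change of variables to the cosine at [b]: its derivative in [a] is
[chord_density b a].  The chords that start at [b] itself or at 0 are lost in
cutting ]0, L[ at [b], which removes at most one cosine. *)
Lemma column_measure b (S : set R) : 0 < b < L -> open S ->
  S `<=` [set a | gamma b <> gamma a] ->
  (forall a a', gamma a = gamma a' -> S a -> S a') ->
  (\int[mu]_(a in `]0%R, L[%classic) (chord_density gamma b a * \1_S a)%:E)%E =
  mu [set - k b a | a in S].
Proof.
move=> hb oS Sb Sper; set X := [set _ | _ in S].
pose f a := (chord_density gamma b a * \1_S a)%:E.
have mX : measurable X by apply: open_measurable; exact: aimcos_image_open.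
have inj a a' : gamma b <> gamma a -> S a' -> - k b a' = - k b a -> S a.
  move=> ba Sa' /oppr_inj e; apply: (Sper a') => //.
  exact: (aimcos_inj hD hg (Sb _ Sa') ba e).
have fE a : gamma b <> gamma a -> f a = (chord_density gamma b a * \1_X (- k b a))%:E.
  move=> ba; rewrite /f !indicE; congr (_ * (nat_of_bool _)%:R)%:E.
  apply/idP/idP; rewrite !inE; first by move=> Sa; exists a.
  by move=> [a' Sa' e]; exact: inj ba Sa' e.
have mf : measurable_fun setT f.
  have -> : f = EFin \o (chord_density gamma b \_ S).
    apply/funext => a; rewrite /f /= patchE indicE.
    by case: ifPn => _; rewrite ?mulr1 ?mulr0.
  apply/measurable_EFinP; apply/(measurable_restrictT _ _).1; first exact: open_measurable.
  apply: open_continuous_measurable_fun => // a; rewrite inE => /Sb.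
  exact: continuous_chord_density.
have f0 a : (0 <= f a)%E.
  rewrite lee_fin indicE; have [/set_mem/Sb ba|_] := boolP (a \in S); last by rewrite mulr0.
  by rewrite mulr1 ltW// (chord_density_gt0 hD hg).
have c1 : {in `]0, b[, forall a, gamma b <> gamma a}.
  move=> a; rewrite in_itv /= => ha /esym; apply: (gamma_neq hg); lra.
have c2 : {in `]b, L[, forall a, gamma b <> gamma a}.
  by move=> a; rewrite in_itv /= => ha; apply: (gamma_neq hg); lra.
have piece p q : p < q -> {in `]p, q[, forall a, gamma b <> gamma a} ->
    (\int[mu]_(a in `]p, q[%classic) f a)%E = mu (X `&` [set - k b a | a in `]p, q[%classic]).
  move=> pq cpq.
  transitivity (\int[mu]_(a in `]p, q[%classic) (chord_density gamma b a * \1_X (- k b a))%:E)%E.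
    by apply: eq_integral => a; rewrite inE /= => /cpq; exact: fE.
  apply: (change_of_variables pq _ _ _ mX) => a ha.
  - by apply: (is_derive_opp_aimcos hg); apply: cpq; rewrite in_itv.
  - by apply: continuous_chord_density; apply: cpq; rewrite in_itv.
  - by apply: (chord_density_gt0 hD hg); apply: cpq; rewrite in_itv.
have imE p q : {in `]p, q[, forall a, gamma b <> gamma a} ->
    X `&` [set - k b a | a in `]p, q[%classic] = [set - k b a | a in S `&` `]p, q[%classic].
  move=> cpq; apply/seteqP; split => [y [[a' Sa' e] [a ha ea]]|_ [a [Sa ha] <-]].
    by exists a => //; split => //; apply: (inj a a') => //; [exact: cpq|rewrite e].
  by split; exists a.
have mim p q : {in `]p, q[, forall a, gamma b <> gamma a} ->
    measurable (X `&` [set - k b a | a in `]p, q[%classic]).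
  move=> cpq; rewrite imE//; apply: open_measurable; apply: aimcos_image_open.
    by apply: openI => //; exact: interval_open.
  by move=> a [/Sb].
have -> : (\int[mu]_(a in `]0%R, L[%classic) f a = \int[mu]_(a in `]0%R, b[%classic) f a +
    \int[mu]_(a in `]b, L[%classic) f a)%E.
  have -> : `]0, L[%classic = `]0, b]%classic `|` `]b, L[%classic :> set R.
    apply/seteqP; split => a; rewrite /= !in_itv /=; last by case; lra.
    by move=> ha; case: (leP a b) => h; [left|right]; lra.
  rewrite ge0_integral_setU//.
  - congr (_ + _)%E; apply/esym/integral_itv_bndo_bndc. exact: (measurable_funTS mf).
  - apply: measurable_funTS; exact: mf.
  - by apply/disj_setPS => a []; rewrite /= !in_itv /=; lra.
rewrite !piece//; [|lra|lra].
set X1 := X `&` _; set X2 := X `&` _.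
(* Besides the two pieces there is at most the cosine of the chord that starts
     at 0. *)
have -> : X = (X1 `|` X2) `|` (X `&` [set - k b 0]).
  apply/seteqP; split => [y Xy|y [[[]|[]]|[]]//].
  have [a Sa ya] := Xy.
  have [n hn] := fundamental_rep hg a.
  set a' := a + _ in hn; have ea : gamma a' = gamma a by rewrite /a' (gamma_periodic hg).
  have ya' : - k b a' = y by rewrite -ya; congr (- _); exact: (aimcos_eq hg).
  have ba' : gamma b <> gamma a' by rewrite ea; exact: Sb.
  have [a'0|a'0] := eqVneq a' 0; first by right; split => //=; rewrite -a'0 ya'.
  have a'p : 0 < a' by rewrite lt_neqAle eq_sym a'0; lra.
  left; case: (ltgtP a' b) => [h|h|h]; last by case: ba'; rewrite h.
    by left; split => //; exists a' => //=; rewrite in_itv /=; lra.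
  by right; split => //; exists a' => //=; rewrite in_itv /=; lra.
rewrite measureU0//.
- rewrite measureU//; [exact: mim|exact: mim|].
  rewrite -subset0 => y [[_ [a ha e]] [_ [a' ha' e']]].
  have : gamma a = gamma a'.
    apply: (aimcos_inj hD hg (c1 _ ha) (c2 _ ha')).
    by apply: oppr_inj; rewrite e e'.
  move: ha ha'; rewrite /= !in_itv /= => ha ha'; apply: (gamma_neq hg); lra.
- by apply: measurableU; exact: mim.
- by apply: measurableI.
- apply: (@subset_measure0 _ _ _ mu _ [set - k b 0]) => //; first exact: measurableI.
  exact: lebesgue_measure_set1.
Qed.

Section closed_set_of_chords.
Variables (eta : R) (U : set (R * R)).
Hypothesis eta0 : 0 < eta.
Hypothesis oU : open U.
Hypothesis U0 : U !=set0.
Hypothesis Uchord : forall a b, U (a, b) -> gamma a <> gamma b.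
Hypothesis Uper : forall a b a' b', gamma a = gamma a' -> gamma b = gamma b' ->
  U (a, b) -> U (a', b').
Hypothesis Uclosed : forall a b c, U (a, b) -> gamma b <> gamma c ->
  `|k b c + k b a| < eta -> U (b, c).

Let box : set (R * R) := `]0, L[%classic `*` `]0, L[%classic.

Let flux (z : R * R) : \bar R := (chord_density gamma z.1 z.2 * \1_(U `&` box) z)%:E.

Let in_set_of b := [set a | U (a, b)].
Let out_set_of b := [set c | U (b, c)].

Let open_in b : open (in_set_of b).
Proof.
rewrite openE => a Ua; have c1 : x @[x --> a] --> a by exact: cvg_id.
have c2 : (fun=> b) x @[x --> a] --> b by exact: cvg_cst.
have h : nbhs a [set x | U (x, b)] := cvg_pair c1 c2 (oU Ua).
exact: h.
Qed.

Let open_out b : open (out_set_of b).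
Proof.
rewrite openE => a Ua; have c1 : x @[x --> a] --> a by exact: cvg_id.
have c2 : (fun=> b) x @[x --> a] --> b by exact: cvg_cst.
have h : nbhs a [set x | U (b, x)] := cvg_pair c2 c1 (oU Ua).
exact: h.
Qed.

Let in_chord b : in_set_of b `<=` [set a | gamma b <> gamma a].
Proof. by move=> a /Uchord + /= => h /esym. Qed.

Let out_chord b : out_set_of b `<=` [set a | gamma b <> gamma a].
Proof. by move=> a /Uchord. Qed.

Let nu_in b := mu [set - k b a | a in in_set_of b].
Let nu_out b := mu [set - k b a | a in out_set_of b].

Let m_in b : measurable [set - k b a | a in in_set_of b].
Proof. by apply: open_measurable; exact: aimcos_image_open. Qed.

Let m_out b : measurable [set - k b a | a in out_set_of b].
Proof. by apply: open_measurable; exact: aimcos_image_open. Qed.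

Let surj b v : -1 < v < 1 -> exists2 c, gamma b <> gamma c & k b c = v.
Proof.
by move=> /(aimcos_surj hg b)[c hc e]; exists c => //; apply: (gamma_neq hg).
Qed.

Let image_itv b (S : set R) : S `<=` [set a | gamma b <> gamma a] ->
  [set - k b a | a in S] `<=` `]-1, 1[%classic.
Proof.
by move=> Sb _ [a /Sb /(aimcos_itv hD hg) h <-]; rewrite /= in_itv /=; lra.
Qed.

(** Every arriving cosine is a departing cosine, as the exact reflection is
allowed.  In terms of [- aimcos] one of the two sets is reflected. *)
Let nu_le b : (nu_in b <= nu_out b)%E.
Proof.
rewrite /nu_in -lebesgue_measure_opp//; apply: le_measure; rewrite ?inE//.
- exact: measurable_opp_set.
- exact: m_out.
move=> _ [_ [a Ua <-] <-]; rewrite opprK.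
have ka := aimcos_itv hD hg (in_chord Ua).
have [|c bc e] := @surj b (- k b a); first lra.
exists c; last by rewrite e opprK.
by apply: (Uclosed Ua) => //; rewrite e addNr normr0.
Qed.

Let nu_out_le2 b : (nu_out b <= 2%:E)%E.
Proof.
apply: (@le_trans _ _ (mu (`]-1, 1[%classic : set R))).
  apply: le_measure; rewrite ?inE//; first exact: m_out.
  exact: image_itv (@out_chord b).
by rewrite lebesgue_measure_itv /= lte_fin gtrN// -EFinD lee_fin; lra.
Qed.

Let mflux : measurable_fun setT flux.
Proof.
have -> : flux = EFin \o ((fun z => chord_density gamma z.1 z.2) \_ (U `&` box)).
  apply/funext => z; rewrite /flux /= patchE indicE.
  by case: ifPn => _; rewrite ?mulr1 ?mulr0.
have oB : open (U `&` box).
  apply: openI => //; rewrite openE => -[a b] [ha hb].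
  have oI : open (`]0, L[%classic : set R) by exact: interval_open.
  by exists (`]0, L[%classic, `]0, L[%classic) => //; split; exact: oI.
apply/measurable_EFinP; apply/(measurable_restrictT _ _).1; first exact: open_measurable2.
apply: open_continuous_measurable_fun2 => // -[a b] [/Uchord /= ab _].
have ba : gamma b <> gamma a by move=> /esym.
have c1 : (@fst R R) x @[x --> (a, b)] --> a by exact: cvg_fst.
have c2 : (@snd R R) x @[x --> (a, b)] --> b by exact: cvg_snd.
exact: cvgM (cvgM (cvg_aimsin hg c1 c2 ab) (cvg_aimsin hg c2 c1 ba)) (cvg_chord_lenV hg c1 c2 ab).
Qed.

Let flux_ge0 z : (0 <= flux z)%E.
Proof.
rewrite lee_fin indicE; have [/set_mem[Uz _]|_] := boolP (z \in _); last by rewrite mulr0.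
by rewrite mulr1 ltW// (chord_density_gt0 hD hg)//; apply: Uchord; rewrite -surjective_pairing.
Qed.

Let flux_out b : (\int[mu]_c flux (b, c) = if (0 < b < L)%R then nu_out b else 0)%E.
Proof.
case: ifPn => hb.
  rewrite /nu_out -(column_measure hb (@open_out b) (@out_chord b)); last first.
    by move=> a a' e; apply: Uper.
  rewrite [RHS]integral_mkcond; apply: eq_integral => c _; rewrite patchE /flux /=.
  rewrite !indicE; case: ifPn => hc.
    congr (_ * (nat_of_bool _)%:R)%:E; apply/idP/idP; rewrite !inE.
      by move=> [].
    by move: hc; rewrite inE => hc Uc; split => //; split => //=; rewrite in_itv.
  rewrite [in LHS]memNset ?mulr0// => -[_ [_ /= h]].
  by case/negP: hc; rewrite inE.
apply: integral0_eq => c _; rewrite /flux indicE memNset ?mulr0// => -[_ [/= h _]].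
by move: hb; move: h; rewrite in_itv /= => ->.
Qed.

Let flux_in b : (\int[mu]_a flux (a, b) = if (0 < b < L)%R then nu_in b else 0)%E.
Proof.
case: ifPn => hb.
  rewrite /nu_in -(column_measure hb (@open_in b) (@in_chord b)); last first.
    by move=> a a' e; apply: Uper.
  rewrite [RHS]integral_mkcond; apply: eq_integral => c _; rewrite patchE /flux /=.
  rewrite !indicE; case: ifPn => hc.
    rewrite chord_densityC.
    congr (_ * (nat_of_bool _)%:R)%:E; apply/idP/idP; rewrite !inE.
      by move=> [].
    by move: hc; rewrite inE => hc Uc; split => //; split => //=; rewrite in_itv.
  rewrite [in LHS]memNset ?mulr0// => -[_ [/= h _]].
  by case/negP: hc; rewrite inE.
apply: integral0_eq => c _; rewrite /flux indicE memNset ?mulr0// => -[_ [_ /= h]].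
by move: hb; move: h; rewrite in_itv /= => ->.
Qed.

(** Tonelli's theorem for [flux], whose integral over the chords that leave [b]
is [nu_out b] and over those that arrive at [b] is [nu_in b].  Two ordered
functions with the same finite integral agree almost everywhere. *)
Let flux_balance : {ae mu, forall b, 0 < b < L -> nu_out b = nu_in b}.
Proof.
pose fo b := (\int[mu]_c flux (b, c))%E; pose fi b := (\int[mu]_a flux (a, b))%E.
have mo : measurable_fun setT fo by exact: measurable_fun_fubini_tonelli_F.
have mi : measurable_fun setT fi by exact: measurable_fun_fubini_tonelli_G.
have eoi : (\int[mu]_b fo b = \int[mu]_b fi b)%E by exact: fubini_tonelli.
have fi0 b : (0 <= fi b)%E by exact: integral_ge0.
have fio b : (fi b <= fo b)%E.
  by rewrite /fi /fo flux_in flux_out; case: ifP.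
have fo0 b : (0 <= fo b)%E by exact: integral_ge0.
have fo2 b : 0 < b < L -> (fo b <= 2%:E)%E.
  by move=> hb; rewrite /fo flux_out hb.
have foE b : ~~ (0 < b < L) -> fo b = 0%E.
  by move=> /negPf hb; rewrite /fo flux_out hb.
have fofin b : fo b \is a fin_num.
  rewrite (ge0_fin_numE (fo0 b)); have [/fo2 h|/foE->] := boolP (0 < b < L); last exact: ltry.
  by apply: le_lt_trans h _; rewrite ltry.
have foo := integral_bounded_lty mo fo0 fo2 foE (ler0n R 2).
have := ae_eq_le_integral mi mo fi0 fio fofin foo eoi.
move=> [N [mN N0 sN]]; exists N; split; [exact: mN|exact: N0|move=> b /= nb]; apply: sN => /= e; apply: nb => hb.
by move: e; rewrite /fo /fi flux_out flux_in hb.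
Qed.

Let full b := forall c, gamma b <> gamma c -> U (b, c).

(** The arriving cosines at [b] gain no measure when thickened by [eta] in ]-1, 1[,
and there is one; hence every cosine is within [eta] of an arriving one. *)
Let full_of_balance b a : U (a, b) -> nu_out b = nu_in b -> full b.
Proof.
move=> Uab e c bc.
have kc := aimcos_itv hD hg bc.
pose O := [set k b a | a in in_set_of b].
have OE : O = -%R @` [set - k b a | a in in_set_of b].
  apply/seteqP; split => [_ [x Ux <-]|_ [_ [x Ux <-] <-]].
    by exists (- k b x); rewrite ?opprK//; exists x.
  by rewrite opprK; exists x.
have muO : mu O = nu_in b by rewrite OE lebesgue_measure_opp.
have [| | | | | | | | |_ [x Ux <-] hx] := @thickening_full _ O [set - k b a | a in out_set_of b] (-1) 1 eta
   _ _ _ _ _ _ _ _ (- k b c).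
- by rewrite OE; exact: measurable_opp_set.
- exact: m_out.
- exact: eta0.
- by exists (k b a), a.
- move=> _ [x /in_chord /(aimcos_itv hD hg) h <-]; rewrite /= in_itv /=; lra.
- move=> y _ hy [x Ux <-] hyx.
  have [|d bd kd] := @surj b (- y); first lra.
  exists d; last by rewrite kd opprK.
  apply: (Uclosed Ux) => //.
  by rewrite kd -normrN opprD opprK.
- by rewrite muO -e.
- by rewrite muO -e; apply: le_lt_trans (nu_out_le2 b) _; rewrite ltry.
- lra.
apply: (Uclosed Ux) => //.
by rewrite -normrN opprD.
Qed.

Let balance_dense u v : 0 <= u -> u < v -> v <= L ->
  exists2 b, u < b < v & nu_out b = nu_in b.
Proof.
move=> u0 uv vL; apply: contrapT => h.
have [N [mN N0 sN]] := flux_balance.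
have : (mu (`]u, v[%classic : set R) <= mu N)%E.
  apply: le_measure; rewrite ?inE//.
  move=> b; rewrite /= in_itv /= => hb; apply: sN => /= hb'; apply: h.
  by exists b => //; apply: hb'; lra.
rewrite N0 lebesgue_measure_itv /= lte_fin uv -EFinD lee_fin; lra.
Qed.

(** Some chord of [U] arrives at [b1]; as [U] is open, chords of [U] arrive at all
positions near [b1], and almost every one of those is balanced. *)
Let exists_full : exists2 b, 0 < b < L & full b.
Proof.
have [[a b0] Uab0] := U0.
have [n hn] := fundamental_rep hg b0; set b1 := b0 + _ in hn.
have Uab1 : U (a, b1) by apply: Uper Uab0 => //; rewrite /b1 (gamma_periodic hg).
have /nbhs_ballP[r /= r0 hr] := @open_out a b1 Uab1.
have [|||b hb e] := @balance_dense b1 (Num.min (b1 + r) L); first by lra.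
- by rewrite lt_min; apply/andP; split; lra.
- by rewrite ge_min lexx orbT.
move: hb; rewrite lt_min => hb.
exists b; first by lra.
apply: (@full_of_balance b a) => //.
by apply: hr; rewrite -ball_normE /= ltr_norml; lra.
Qed.

(** A full position [b1] sends chords of [U] to every other position, so the
balanced ones among these are full as well. *)
Let full_dense u v : 0 <= u -> u < v -> v <= L ->
  exists2 b, u < b < v & full b.
Proof.
move=> u0 uv vL; have [b1 hb1 fb1] := exists_full.
have aux u' v' : u <= u' -> u' < v' -> v' <= v -> (forall b, u' < b < v' -> b != b1) ->
    exists2 b, u < b < v & full b.
  move=> uu uv' vv ne; have [|||b hb e] := @balance_dense u' v'; [lra|lra|lra|].
  exists b; first by lra.
  apply: (@full_of_balance b b1) => //; apply: fb1 => ge.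
  have : b != b1 by exact: ne.
  move=> /eqP; apply.
  have i1 : b \in `[0, L[ by rewrite in_itv /=; lra.
  have i2 : b1 \in `[0, L[ by rewrite in_itv /=; lra.
  exact: (bp_simple hg i1 i2 (esym ge)).
have [h|h] := boolP (u < b1 < v).
  apply: (@aux b1 v); [lra|lra|lra|move=> b hb; rewrite gt_eqF//; lra].
apply: (@aux u v); [lra|lra|lra|move=> b hb].
by apply: contraNneq h => <-.
Qed.

(** The chord from [x0] to [a] that is reflected into the one from [a] to [b] may
not be in [U], but full positions [t] are dense: for [t] near [x0] the chord from
[t] to [a] is in [U] and is still followed by the one from [a] to [b], up to the
allowed error. *)
Lemma closed_set_of_chords_full a b : gamma a <> gamma b -> U (a, b).
Proof.
move=> ab.
have kab := aimcos_itv hD hg ab.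
have [|x ax kx] := @surj a (- k a b); first lra.
(* [x0] represents the chord whose exact reflection at [a] is the one towards [b]. *)
have [n hn] := fundamental_rep hg x; set x0 := x + _ in hn.
have ex : gamma x0 = gamma x by rewrite /x0 (gamma_periodic hg).
have ax0 : gamma a <> gamma x0 by rewrite ex.
have kx0 : k a x0 = - k a b by rewrite (aimcos_eq hg (erefl (gamma a)) ex).
have c1 : t @[t --> x0] --> x0 by exact: cvg_id.
have c2 : (fun=> a) t @[t --> x0] --> a by exact: cvg_cst.
have n1 := near_chord hg c2 c1 ax0.
have e0 : `|k a b + k a x0| < eta by rewrite kx0 subrr normr0.
have n2 : \forall t \near x0, `|k a b + k a t| < eta.
  exact: (cvg_norm (cvgD (cvg_cst (k a b)) (cvg_aimcos hg c2 c1 ax0)) (lt_nbhsl e0)).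
have n3 : \forall t \near x0, gamma a <> gamma t /\ `|k a b + k a t| < eta.
  by near=> t; split; near: t; [exact: n1|exact: n2].
have /nbhs_ballP[r /= r0 hr] := n3.
have [|||t ht ft] := @full_dense x0 (Num.min (x0 + r) L); first by lra.
- by rewrite lt_min; apply/andP; split; lra.
- by rewrite ge_min lexx orbT.
move: ht; rewrite lt_min => ht.
have [|at' h] := hr t; first by rewrite -ball_normE /= ltr_norml; lra.
by apply: (@Uclosed t) => //; apply: ft => /esym.
Unshelve. all: by end_near.
Qed.

End closed_set_of_chords.
End transitivity.

(** * Chains of chords *)

(** The modulus of injectivity of the cosine on [0, pi] is attained at the ends of
the interval, where the cosine is flattest. *)
Lemma cos_close (R : realType) (eps u v : R) : 0 <= eps <= pi ->
  0 <= u <= pi -> 0 <= v <= pi -> `|cos u - cos v| < 1 - cos eps -> `|u - v| < eps.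
Proof.
move=> he; wlog uv : u v / u <= v => [wl hu hv|hu hv].
  have [/wl h|/ltW/wl h] := leP u v; first exact: h.
  by rewrite distrC [ltRHS]/= => hc; rewrite distrC; apply: h => //.
rewrite ltNge => /negP h; rewrite distrC ger0_norm ?subr_ge0// ltNge; apply/negP => ed.
apply: h; set d := v - u in ed.
have hd : 0 <= d <= pi by rewrite /d; lra.
have c1 : cos d <= cos eps by rewrite leNgt ltr_cos ?in_itv //= -leNgt.
have c2 : - cos d <= cos u.
  have -> : - cos d = cos (pi - d) by rewrite cosB cospi sinpi mul0r addr0 mulN1r.
  by rewrite leNgt ltr_cos ?in_itv /= /d -?leNgt; lra.
have -> : v = u + d by rewrite /d; lra.
apply: le_trans (ler_norm _); rewrite cosD.
have su : 0 <= sin u by exact: sin_ge0_pi.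
have sd : 0 <= sin d by exact: sin_ge0_pi.
have e1 := cos2Dsin2 u; have e2 := cos2Dsin2 d.
have h1 := cos_le1 u; have h2 := cos_le1 d.
have : (1 - cos u) * (1 - cos d) <= sin u * sin d; last lra.
rewrite -ler_sqr ?nnegrE ?mulr_ge0 ?subr_ge0//.
have -> : (sin u * sin d) ^+ 2 = ((1 - cos u) * (1 - cos d)) * ((1 + cos u) * (1 + cos d)).
  have s1 : sin u ^+ 2 = (1 - cos u) * (1 + cos u) by rewrite -subr_sqr expr1n; lra.
  have s2 : sin d ^+ 2 = (1 - cos d) * (1 + cos d) by rewrite -subr_sqr expr1n; lra.
  by rewrite exprMn s1 s2; ring.
rewrite expr2 ler_wpM2l ?mulr_ge0 ?subr_ge0//; lra.
Qed.

Section reachability.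
Context {R : realType} (D : set (plane R)) (L : R) (gamma : R -> plane R).
Hypothesis hD : strictly_convex_domain D.
Hypothesis hg : boundary_param D L gamma.
Implicit Types (a b c s t : R) (e f g : R * R).

Local Notation k := (aimcos gamma).

Variable eta : R.
Hypothesis eta0 : 0 < eta.

Definition chord e := gamma e.1 <> gamma e.2.

(** The angles of reflection and departure are compared through their cosines;
the tolerance [eta = 1 - cos eps] ensures that the angles differ by less than
[eps]. *)
Definition bounce e f := [/\ e.2 = f.1, chord f & `|k f.1 f.2 + k e.2 e.1| < eta].

Fixpoint reach n e f := if n is m.+1 then exists2 g, reach m e g & bounce g f else e = f.

Lemma reach_chord n e f : chord e -> reach n e f -> chord f.
Proof. by case: n => [|n] ce /= => [<-//|[g _ []]]. Qed.

Lemma reachD m n e f g : reach m e f -> reach n f g -> reach (m + n) e g.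
Proof.
move=> ef; elim: n g => [g <-|n IH g [x fx xg]]; first by rewrite addn0.
by rewrite addnS; exists x => //; exact: IH.
Qed.

Lemma reach1 e f : bounce e f -> reach 1 e f.
Proof. by exists e. Qed.

Lemma bounceP a b c : gamma b <> gamma c -> `|k b c + k b a| < eta -> bounce (a, b) (b, c).
Proof. by []. Qed.

Lemma specular a b : gamma a <> gamma b -> exists c, bounce (a, b) (b, c).
Proof.
move=> ab; have ba : gamma b <> gamma a by move=> /esym.
have := aimcos_itv hD hg ba => h.
have [|c hc kc] := @aimcos_surj _ _ _ _ hg b (- k b a); first lra.
exists c; apply: bounceP; first exact: (gamma_neq hg hc).
by rewrite kc addNr normr0.
Qed.

Lemma specular_inv b c : gamma b <> gamma c -> exists a, gamma a <> gamma b /\ bounce (a, b) (b, c).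
Proof.
move=> bc; have := aimcos_itv hD hg bc => h.
have [|a ha ka] := @aimcos_surj _ _ _ _ hg b (- k b c); first lra.
exists a; split; first by move=> /esym; exact: (gamma_neq hg ha).
by apply: bounceP => //; rewrite ka subrr normr0.
Qed.

(** The set of reachable chords would not be open if the last step were the only
one, since its starting point is then fixed; with two steps the starting point
of the last chord varies as well. *)
Lemma reach_all e f : chord e -> chord f -> exists n, reach n.+2 e f.
Proof.
case: e f => [a0 b0] [a b] ce cf.
pose U := [set f | exists n, reach n.+2 (a0, b0) f].
suff : U (a, b) by [].
apply: (closed_set_of_chords_full hD hg eta0) cf => //.
- rewrite openE => -[c d] [n [[b1 c1] [[a1 b2] re [/= e1 ch1 k1]] [/= e2 ch2 k2]]].
  subst c1 b2; rewrite /chord /= in ch1 ch2.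
  have hc : (@fst R R) x @[x --> (c, d)] --> c by exact: cvg_fst.
  have hd : (@snd R R) x @[x --> (c, d)] --> d by exact: cvg_snd.
  have hb : (fun=> b1) x @[x --> (c, d)] --> b1 by exact: cvg_cst.
  have cb : gamma c <> gamma b1 by move=> /esym.
  have n1 := near_chord hg hb hc ch1.
  have n2 := near_chord hg hc hd ch2.
  have n3 : \forall x \near (c, d), `|k b1 x.1 + k b1 a1| < eta.
    exact: (cvg_norm (cvgD (cvg_aimcos hg hb hc ch1) (cvg_cst (k b1 a1))) (lt_nbhsl k1)).
  have n4 : \forall x \near (c, d), `|k x.1 x.2 + k x.1 b1| < eta.
    exact: (cvg_norm (cvgD (cvg_aimcos hg hc hd ch2) (cvg_aimcos hg hc hb cb)) (lt_nbhsl k2)).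
  near=> x; exists n; exists (b1, x.1).
    exists (a1, b1) => //; split => //=; first by near: x; exact: n1.
    by near: x; exact: n3.
  by split => //=; near: x; [exact: n2|exact: n4].
- have [c h1] := specular ce; have [_ ch1 _] := h1.
  have [d h2] := specular ch1.
  by exists (c, d), 0%N; exists (b0, c) => //; exists (a0, b0).
- by move=> x y [n [g _ []]].
- move=> x y x' y' ex ey [n [[b1 c1] [[a1 b2] re [/= e1 ch1 k1]] [/= e2 ch2 k2]]].
  subst c1 b2; rewrite /chord /= in ch1 ch2.
  exists n; exists (b1, x').
    by exists (a1, b1) => //; split; rewrite /chord /= -?ex// -(aimcos_eq hg (erefl (gamma b1)) ex).
  split; rewrite /chord /= -?ex -?ey//.
  by rewrite -(aimcos_eq hg ex ey) -(aimcos_eq hg ex (erefl (gamma b1))).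
- by move=> x y z [n rn] yz kyz; exists n.+1; exists (x, y).
Unshelve. all: by end_near.
Qed.

(** Near the diagonal any two consecutive short forward chords are almost tangent,
so one may follow the other.  The positions 0, 1, 3, 4 and 0, 1, 2, 3, 4 (in
units of [d / 8]) give chains from the chord (0, 1) to the chord (3, 4) of lengths
2 and 3. *)
Lemma reach_loops : exists e K, chord e /\ forall j, (K <= j)%N -> reach j e e.
Proof.
have [d d0 hd] := near_diagonal hg 0 (divr_gt0 eta0 (ltr0Sn R 1)).
have step x y z : -d < x -> x < y -> y < z -> z < d -> bounce (x, y) (y, z).
  move=> dx xy yz zd.
  have [xy1 _ h1] := hd x y ltac:(lra) xy ltac:(lra).
  have [yz1 h2 _] := hd y z ltac:(lra) yz ltac:(lra).
  have yx1 : gamma y <> gamma x by move=> /esym.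
  have b1 := aimcos_itv hD hg yx1; have b2 := aimcos_itv hD hg yz1.
  by apply: bounceP => //; rewrite ltr_norml; lra.
pose g i := i * (d / 8).
have s1 : bounce (g 0, g 1) (g 1, g 3) by apply: step; rewrite /g; lra.
have s2 : bounce (g 1, g 3) (g 3, g 4) by apply: step; rewrite /g; lra.
have s3 : bounce (g 0, g 1) (g 1, g 2) by apply: step; rewrite /g; lra.
have s4 : bounce (g 1, g 2) (g 2, g 3) by apply: step; rewrite /g; lra.
have s5 : bounce (g 2, g 3) (g 3, g 4) by apply: step; rewrite /g; lra.
have ce : chord (g 0, g 1).
  by have [] := hd (g 0) (g 1) ltac:(rewrite /g; lra) ltac:(rewrite /g; lra) ltac:(rewrite /g; lra).
have cf : chord (g 3, g 4) by have [] := s2.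
have [n rn] := reach_all cf ce.
set e := (g 0, g 1) in s1 s3 ce rn *.
pose P := (2 + n.+2)%N.
have l1 : reach P e e := reachD (reachD (reach1 s1) (reach1 s2)) rn.
have l2 : reach P.+1 e e :=
  reachD (reachD (reachD (reach1 s3) (reach1 s4)) (reach1 s5)) rn.
have mul m q : reach m e e -> reach (q * m) e e.
  move=> rm; elim: q => [|q IH]; first by rewrite mul0n.
  by rewrite mulSn; exact: (reachD rm IH).
exists e, (P * P)%N; split => // j hj.
(* [j = q * P + r] with [r < P <= q] is [q - r] times [P] plus [r] times [P + 1]. *)
have -> : j = ((j %/ P - j %% P) * P + (j %% P) * P.+1)%N.
  have h1 := divn_eq j P; have h2 : (j %% P < P)%N by rewrite ltn_mod.
  have h3 : (P <= j %/ P)%N by rewrite leq_divRL.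
  by rewrite {1}h1; nia.
exact: (reachD (mul _ _ l1) (mul _ _ l2)).
Qed.

End reachability.

(** * Uniform lower bound *)

Section minorization_everywhere.
Context {R : realType} (D : set (plane R)) (L : R) (gamma : R -> plane R).
Hypothesis hD : strictly_convex_domain D.
Hypothesis hg : boundary_param D L gamma.
Variables (eps : R) (p : nat -> R * R -> R * R -> \bar R).
Hypothesis heps : 0 < eps < pi / 2.
Hypothesis hp : step_density L gamma eps p.
Implicit Types (a b c s t u v w : R) (e f g : R * R).

Local Notation k := (aimcos gamma).
Local Notation depart := (depart gamma).
Local Notation arrive := (arrive gamma).
Local Notation chord := (chord gamma).

Let eta := 1 - cos eps.
Local Notation reach := (reach gamma eta).
Local Notation bounce := (bounce gamma eta).
Local Notation minorized := (minorized L gamma p).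

Let eta0 : 0 < eta.
Proof.
rewrite subr_gt0 -cos0 ltr_cos ?in_itv /= ?lexx ?pi_ge0//; have := heps; lra.
Qed.

Lemma bounce_angle e f : chord e -> bounce e f ->
  `|depart f.1 f.2 - arrive e.1 e.2| < eps.
Proof.
move=> ce [ef cf kef].
have /andP[d0 d1] := depart_itv hD hg cf; have /andP[a0 a1] := arrive_itv hD hg ce.
have he := heps; apply: cos_close; [lra|lra|lra|].
by rewrite (cos_depart hD hg)// (cos_arrive hD hg)// opprK.
Qed.

(** Induction on the chain from its first chord: each step of [minorizedS] removes
one chord, and [minorized2] treats the last one. *)
Lemma minorized_reach n e f v w : chord e -> reach n e f ->
  `|depart e.1 e.2 - v| < eps -> `|w - arrive f.1 f.2| < eps ->
  minorized n.+2 ((e.1, v), (f.2, w)).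
Proof.
move=> ce ref hv hw.
have aux m q : (2 <= m)%N -> reach n e f ->
    (forall v', `|depart f.1 f.2 - v'| < eps -> minorized m ((f.1, v'), q)) ->
    minorized (n + m) ((e.1, v), q).
  elim: n f m {ref hw} => [f m _ <-|n IH f m m2 [g rg bg] hf]; first exact.
  rewrite addSnnS; apply: (IH g m.+1 _ rg); first exact: leqW.
  have cg := reach_chord ce rg; have [gf cf _] := bg.
  move=> v' hv'; apply: (minorizedS hD hg heps hp m2 cg hv').
  by have ba := bounce_angle cg bg; rewrite gf in ba *; exact: hf.
rewrite -addn2; apply: aux => // v' hv'.
by apply: (minorized2 hD hg heps hp) => //; exact: reach_chord ce ref.
Qed.

(** The chords [e] and [f] are the first and the last of a chain from the position
of [z.1] to that of [z.2]; [e] leaves within [eps] of the angle of [z.1], and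
[f] is reflected within [eps] of the angle of [z.2]. *)
Definition joined n (z : (R * R) * (R * R)) := exists e f,
  [/\ chord e, reach n e f, e.1 = z.1.1 /\ f.2 = z.2.1,
      `|depart e.1 e.2 - z.1.2| < eps & `|z.2.2 - arrive f.1 f.2| < eps].

Lemma minorized_joined n z : joined n z -> minorized n.+2 z.
Proof.
case: z => [[s v] [t w]] [e [f [ce ref [/= <- <-]]]]; exact: minorized_reach.
Qed.

(** The angles 0 and pi belong to the phase space but not to chords. *)
Lemma near_angle v : 0 <= v <= pi -> exists2 u, 0 < u < pi & `|u - v| < eps.
Proof.
move=> hv; have := heps => he; have [h|h] := leP v (pi / 2).
  by exists (v + eps / 2); [lra|rewrite ltr_norml; lra].
by exists (v - eps / 2); [lra|rewrite ltr_norml; lra].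
Qed.

Lemma departing_chord s v : 0 <= v <= pi ->
  exists2 t, gamma s <> gamma t & `|depart s t - v| < eps.
Proof.
move=> /near_angle[u hu huv]; have [t [_ st ut]] := depart_surj hg s hu.
by exists t => //; rewrite -ut.
Qed.

Lemma arriving_chord t w : 0 <= w <= pi ->
  exists2 s, gamma s <> gamma t & `|w - arrive s t| < eps.
Proof.
move=> hw; have [|s ts hs] := @departing_chord t (pi - w); first lra.
have st : gamma s <> gamma t by move=> /esym.
exists s => //; rewrite (arriveE hD hg)//.
by rewrite (_ : w - _ = depart t s - (pi - w)) //; ring.
Qed.

(** A chain through a chord [h] that has loops of all large lengths, which make up
any large number of chords.  Only the first and the last position depend on the
pair of phase points, and a small change of them respects the strict
inequalities on the angles, so all nearby pairs are joined too. *)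
Lemma near_joined (z : (R * R) * (R * R)) : 0 <= z.1.2 <= pi -> 0 <= z.2.2 <= pi ->
  exists N, \forall z' \near z, forall n, (N <= n)%N -> joined n z'.
Proof.
case: z => [[s v] [t w]] /= hv hw.
have [h [K [ch loops]]] := reach_loops hD hg eta0.
have [a sa hsa] := departing_chord s hv.
have [b bt hbt] := arriving_chord t hw.
have as' : gamma a <> gamma s by move=> /esym.
have [a2 [_ ca ka]] := specular hD hg eta0 sa.
have [b2 [cb bb]] := specular_inv hD hg eta0 bt.
have [n1 r1] := reach_all hD hg eta0 ca ch.
have [n2 r2] := reach_all hD hg eta0 ch (cb : chord (b2, b)).
rewrite /= in ka.
exists (1 + n1.+2 + n2.+2 + 1 + K)%N.
set z0 : (R * R) * (R * R) := ((s, v), (t, w)).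
have c1 : (fun q : (R * R) * (R * R) => q.1.1) q @[q --> z0] --> s.
  by apply: (cvg_comp fst fst); [exact: cvg_fst|exact: cvg_fst].
have c2 : (fun q : (R * R) * (R * R) => q.1.2) q @[q --> z0] --> v.
  by apply: (cvg_comp fst snd); [exact: cvg_fst|exact: cvg_snd].
have c3 : (fun q : (R * R) * (R * R) => q.2.1) q @[q --> z0] --> t.
  by apply: (cvg_comp snd fst); [exact: cvg_snd|exact: cvg_fst].
have c4 : (fun q : (R * R) * (R * R) => q.2.2) q @[q --> z0] --> w.
  by apply: (cvg_comp snd snd); [exact: cvg_snd|exact: cvg_snd].
have cca : (fun=> a) q @[q --> z0] --> a by exact: cvg_cst.
have ccb : (fun=> b) q @[q --> z0] --> b by exact: cvg_cst.
have n1' := near_chord hg c1 cca sa.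
have n2' := near_chord hg ccb c3 bt.
have n3 : \forall q \near z0, `|depart q.1.1 a - q.1.2| < eps.
  exact: (cvg_norm (cvgB (cvg_depart hD hg c1 cca sa) c2) (lt_nbhsl hsa)).
have n4 : \forall q \near z0, `|q.2.2 - arrive b q.2.1| < eps.
  exact: (cvg_norm (cvgB c4 (cvg_arrive hD hg ccb c3 bt)) (lt_nbhsl hbt)).
have n5 : \forall q \near z0, `|k a a2 + k a q.1.1| < eta.
  exact: (cvg_norm (cvgD (cvg_cst (k a a2)) (cvg_aimcos hg cca c1 as')) (lt_nbhsl ka)).
have [_ _ /= kb] := bb.
have n6 : \forall q \near z0, `|k b q.2.1 + k b b2| < eta.
  exact: (cvg_norm (cvgD (cvg_aimcos hg ccb c3 bt) (cvg_cst (k b b2))) (lt_nbhsl kb)).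
near=> q => n Nn.
have sa' : gamma q.1.1 <> gamma a by near: q; exact: n1'.
have bt' : gamma b <> gamma q.2.1 by near: q; exact: n2'.
exists (q.1.1, a), (b, q.2.1); split => //=.
- have b1 : bounce (q.1.1, a) (a, a2) by split => //=; near: q; exact: n5.
  have b3 : bounce (b2, b) (b, q.2.1) by split => //=; near: q; exact: n6.
  have rl : reach (n - (1 + n1.+2 + n2.+2 + 1)) h h.
    by apply: loops; move: Nn; clear; lia.
  have := reachD (reachD (reachD (reachD (reach1 b1) r1) rl) r2) (reach1 b3).
  by congr (reach _ _ _); move: Nn; clear; lia.
- by near: q; exact: n3.
- by near: q; exact: n4.
Unshelve. all: by end_near.
Qed.

Let Z : set ((R * R) * (R * R)) :=
  (`[0, L]%classic `*` `[0, pi]%classic) `*` (`[0, L]%classic `*` `[0, pi]%classic).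

Let compactZ : compact Z.
Proof. by do 2 apply: compact_setX; apply: segment_compact. Qed.

Lemma uniformly_joined : exists N, forall z, Z z -> joined N z.
Proof.
have /compact_near_coveringP cZ := compactZ.
have [z [[_ h1] [_ h2]]|N _ hN] := cZ nat \oo (fun N z => forall n, (N <= n)%N -> joined n z) _.
  move: h1 h2; rewrite /= !in_itv /= => h1 h2.
  have [N hN] := near_joined h1 h2.
  near=> q i.
  have Ni : (N <= i)%N by near: i; exact: nbhs_infty_ge.
  have hq : forall n, (N <= n)%N -> joined n q by near: q; exact: hN.
  by move=> n ni; apply: hq; exact: leq_trans ni.
exists N => z Zz; exact: (hN N (leqnn N) z Zz N (leqnn N)).
Unshelve. all: by end_near.
Qed.

Lemma uniformly_minorized : exists N c, [/\ (2 <= N)%N, 0 < c &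
  forall z, Z z -> density_ge L gamma p N c z].
Proof.
have [N hN] := uniformly_joined; exists N.+2.
have /compact_near_coveringP cZ := compactZ.
have [z Zz|m _ hm] := cZ nat \oo (fun m z => density_ge L gamma p N.+2 m.+1%:R^-1 z) _.
  have [c c0 hc] := minorized_joined (hN z Zz).
  near=> q m.
  have h : density_ge L gamma p N.+2 c q by near: q; exact: hc.
  have mc : m.+1%:R^-1 < c by near: m; exact: (near_infty_natSinv_lt (PosNum c0)).
  move=> x y Mx My e1 e2 e3 e4.
  by apply: le_trans (h x y Mx My e1 e2 e3 e4); rewrite lee_fin ltW.
by exists m.+1%:R^-1; split => //; exact: (hm m (leqnn m)).
Unshelve. all: by end_near.
Qed.

End minorization_everywhere.

Theorem proposition6 (R : realType) (D : set (plane R)) (L : R)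
    (gamma : R -> plane R)
    (hD : strictly_convex_domain D) (hgamma : boundary_param D L gamma)
    (eps : R) (heps : 0 < eps < pi / 2)
    (p : nat -> R * R -> R * R -> \bar R)
    (hp : step_density L gamma eps p) :
  exists (b : R) (N : nat), [/\ 0 < b, (2 <= N)%N
    & forall x y : R * R, phase_space L x -> phase_space L y ->
        (b%:E < p N x y)%E].
Proof.
have [N [c [N2 c0 hc]]] := uniformly_minorized hD hgamma heps hp.
exists (c / 2), N; split => //; first by rewrite divr_gt0.
move=> x y Mx My; apply: (@lt_le_trans _ _ c%:E); first by rewrite lte_fin; lra.
have /phase_spaceP[h1 h2] := billiard_phase hD hgamma Mx.
have /phase_spaceP[h3 h4] := My.
apply: (hc (billiard_map L gamma x, y)) => //.
by split; split; rewrite /= in_itv /=; lra.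
Qed.
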